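(* As $q\to\infty$, $$T(\Omega_q)=\frac{q^3}{16}+\frac{q}{48}-\frac{\zeta(3)}{2\pi^3}+O(q^{-1}).$$
   Context: For $q>0$ let $\Omega_q=\{(x,y)\in\mathbb R^2:0<x<q,\ 0<y<1-x/q\}$ be the open right triangle with vertices $A=(0,0)$, $B_q=(q,0)$, $C=(0,1)$. Let $u_q$ be the (weak) solution of the mixed boundary value problem $$-\Delta u_q=1\ \text{in }\Omega_q,\qquad u_q=0\ \text{on the side }AC,\qquad \partial_\nu u_q=0\ \text{on the sides }AB_q\cup B_qC,$$ where $\nu$ is the outward unit normal. The mixed torsional rigidity is $T(\Omega_q)=\int_{\Omega_q}u_q\,dx\,dy$. $\zeta$ is the Riemann zeta function. *)

(* Defs.v *)
From HB Require Import structures.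
From mathcomp Require Import all_boot all_order all_algebra.
From mathcomp Require Import all_classical all_reals all_analysis.
Set Implicit Arguments.
Unset Strict Implicit.
Unset Printing Implicit Defensive.
Import Order.TTheory GRing.Theory Num.Theory.
Import numFieldNormedType.Exports.
Local Open Scope classical_set_scope.
Local Open Scope ring_scope.

Notation leb2 R := (@lebesgue_measure R \x @lebesgue_measure R)%E.

(* The library's Landau notations need the filter as a [filter_on]. *)
Canonical pinfty_filter_on (R : realType) : filter_on R :=
  FilterType (pinfty_nbhs R) _.

Section Plane.
Context {R : realType}.

Definition partial1 (f : R * R -> R) (z : R * R) : R :=
  derive1 (fun t : R => f (t, z.2)) z.1.
Definition partial2 (f : R * R -> R) (z : R * R) : R :=
  derive1 (fun t : R => f (z.1, t)) z.2.

Fixpoint is_Ck (k : nat) (f : R * R -> R) : Prop :=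
  if k is k'.+1 then
    [/\ continuous f,
        forall z : R * R, derivable (fun t : R => f (t, z.2)) z.1 1,
        forall z : R * R, derivable (fun t : R => f (z.1, t)) z.2 1,
        is_Ck k' (partial1 f) & is_Ck k' (partial2 f)]
  else continuous f.

Definition smooth (f : R * R -> R) : Prop := forall k, is_Ck k f.

Definition test_function (U : set (R * R)) (phi : R * R -> R) : Prop :=
  smooth phi /\
  exists K : set (R * R),
    [/\ compact K, K `<=` U & forall z, ~ K z -> phi z = 0].

Definition square_integrable (U : set (R * R)) (f : R * R -> R) : Prop :=
  measurable_fun (U : set (measurableTypeR R * measurableTypeR R)) f /\
  (leb2 R).-integrable U (fun z => ((f z) ^+ 2)%:E).

Definition weak_gradient (U : set (R * R)) (f g1 g2 : R * R -> R) : Prop :=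
  forall phi, test_function U phi ->
    (\int[leb2 R]_(z in U) (f z * partial1 phi z))
      = - (\int[leb2 R]_(z in U) (g1 z * phi z)) /\
    (\int[leb2 R]_(z in U) (f z * partial2 phi z))
      = - (\int[leb2 R]_(z in U) (g2 z * phi z)).

(* [H1 U f g1 g2]: f belongs to H^1(U), and (g1, g2) is its weak gradient
   (which is determined up to a null set). *)
Definition H1 (U : set (R * R)) (f g1 g2 : R * R -> R) : Prop :=
  [/\ square_integrable U f, square_integrable U g1,
      square_integrable U g2 & weak_gradient U f g1 g2].

(* The functions of H^1(U) with zero trace on D, for D in the boundary of U:
   the closure, in the H^1(U) norm, of the restrictions to U of smooth functions
   on the plane that vanish on D. *)
Definition H1_zero_on (U D : set (R * R)) (f g1 g2 : R * R -> R) : Prop :=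
  H1 U f g1 g2 /\
  forall e : R, 0 < e -> exists phi : R * R -> R,
    [/\ smooth phi, forall z, D z -> phi z = 0 &
      ((\int[leb2 R]_(z in U) ((phi z - f z) ^+ 2
         + (partial1 phi z - g1 z) ^+ 2
         + (partial2 phi z - g2 z) ^+ 2)%:E) < (e ^+ 2)%:E)%E].

(* Weak form of -Delta u = 1 in U, u = 0 on D, and zero normal derivative on
   the rest of the boundary of U: the Neumann condition is the natural one, so
   it is encoded by testing against all v that vanish on D only. *)
Definition weak_solution (U D : set (R * R)) (u : R * R -> R) : Prop :=
  exists g1 g2 : R * R -> R, H1_zero_on U D u g1 g2 /\
    forall v h1 h2 : R * R -> R, H1_zero_on U D v h1 h2 ->
      (\int[leb2 R]_(z in U) (g1 z * h1 z + g2 z * h2 z))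
        = \int[leb2 R]_(z in U) v z.

Definition triangle (q : R) : set (R * R) :=
  [set z | [/\ 0 < z.1, z.1 < q, 0 < z.2 & z.2 < 1 - z.1 / q]].

Definition sideAC : set (R * R) := [set z | z.1 = 0 /\ 0 <= z.2 <= 1].

(* The Riemann zeta function at a real argument s > 1. *)
Definition zeta (s : R) : R := limn (series (fun n : nat => n.+1%:R `^ (- s))).

End Plane.

(* Main.v *)
Require Import Defs.
From mathcomp Require Import all_boot all_order all_algebra.
From mathcomp Require Import all_classical all_reals all_analysis.
From mathcomp Require Import measurable_realfun ring lra zify.
Import Order.TTheory GRing.Theory Num.Theory.
Import numFieldNormedType.Exports.
Local Open Scope classical_set_scope.
Local Open Scope ring_scope.

(** Write L(x) = 1 - x/q for the height of the triangle above x, and W for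
q^3/16 + q/48.

The function w(x,y) = (2qx - x^2 - y^2)/4 is, up to a constant, -r^2/4 with r
the distance to B, so that -Delta w = 1 and its normal derivative vanishes on
both sides that meet at B.  Its Dirichlet energy is exactly W
([radial_energy]).  It fails to be the solution only because w = -y^2/4 on AC.
Two dual variational principles, obtained by completing a square, measure the
effect of this defect.

- If phi is smooth and equals y^2/4 on AC, then w + phi is admissible in
  Dirichlet's principle, and the torsional rigidity is at least W minus the
  Dirichlet energy of phi ([torsion_lower]).
- If rho is divergence-free with zero flux through AB and BC, then grad w + rho
  is admissible in Thomson's principle, and the torsional rigidity is at most
  the integral of |grad w + rho|^2.  Green's formula turns the cross term into
  an integral over AC ([torsion_upper]).

Both corrections to W can be brought within O(1/q) of minus the Dirichlet energy
of the harmonic function on the half-strip x > 0, 0 < y < 1 with zero normal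
derivative on the two long sides and trace y^2/4 on the short one.  As y^2/4 has the cosine coefficient
(-1)^i / k^2 at the frequency k = i pi, this energy is the sum of 1/(2 k^3),
that is zeta(3)/(2 pi^3) ([strip_energyE]).

For the lower bound the triangle is a subset of the half-strip, so the first n
modes of this harmonic function have at most the energy of the half-strip; the
part of y^2/4 that they miss is added with the factor exp(-x), and its energy
tends to 0 with n.  This last point is Parseval's identity for y/2, or
equivalently Euler's value of zeta(2) ([defect_small], [torsion_lower_strip]).

For the upper bound rho is the rotated gradient of the sum of the modes
sin(k y / L) exp(-k x) L^2, which vanish on AB and BC.  Squeezing the conjugate
modes of the half-strip into the triangle in this way changes the energy only
by a factor 1 + O(1/q), uniformly in n ([rho_energy],
[torsion_upper_strip]). *)

(** * Derivatives by syntactic rules, and the fundamental theorem of calculus *)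

Section Calculus.
Context {R : realType}.
Implicit Types (f g F : R -> R) (x t a b c : R).

Lemma deriv_cst x c : is_derive x 1 (fun=> c : R) 0.
Proof. exact: is_derive_cst. Qed.

Lemma deriv_id x : is_derive x 1 (fun t : R => t) 1.
Proof. exact: is_derive_id. Qed.

Lemma deriv_scale x c : is_derive x 1 ( *%R c) c.
Proof. by have := is_deriveZ c (is_derive_id x 1); rewrite /GRing.scale /= mulr1. Qed.

Lemma deriv_shift x c : is_derive x 1 ( +%R c) 1.
Proof.
have := is_deriveD (is_derive_cst c x 1) (is_derive_id x 1).
by rewrite add0r.
Qed.

Lemma deriv_oppr x : is_derive x 1 -%R (- 1).
Proof. exact: (is_deriveN (is_derive_id x 1)). Qed.

Lemma deriv_add f g x a b : is_derive x 1 f a -> is_derive x 1 g b ->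
  is_derive x 1 (fun t => f t + g t) (a + b).
Proof. by move=> df dg; exact: (is_deriveD (f := f) (g := g)). Qed.

Lemma deriv_opp f x a : is_derive x 1 f a -> is_derive x 1 (fun t => - f t) (- a).
Proof. by move=> df; exact: (is_deriveN (f := f)). Qed.

Lemma deriv_mul f g x a b : is_derive x 1 f a -> is_derive x 1 g b ->
  is_derive x 1 (fun t => f t * g t) (a * g x + f x * b).
Proof.
move=> df dg.
apply: (@is_derive_eq _ _ _ (fun t => f t * g t) x 1 _ _ (is_deriveM (f := f) (g := g) df dg)).
by rewrite /GRing.scale /=; ring.
Qed.

Lemma deriv_cmul f x a c : is_derive x 1 f a ->
  is_derive x 1 (fun t => c * f t) (c * a).
Proof.
move=> df; apply: is_derive_eq (deriv_mul _ _ _ _ _ (deriv_cst x c) df) _.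
by rewrite mul0r add0r.
Qed.

Lemma deriv_exprn f x a n : is_derive x 1 f a ->
  is_derive x 1 (fun t => f t ^+ n) (n%:R * f x ^+ n.-1 * a).
Proof.
move=> df; have -> : (fun t => f t ^+ n) = f ^+ n by rewrite exprfctE.
exact: is_deriveX.
Qed.

Lemma deriv_comp (h : R -> R) f x a b : is_derive (f x) 1 h a ->
  is_derive x 1 f b -> is_derive x 1 (fun t => h (f t)) (a * b).
Proof. exact: is_derive1_comp. Qed.

Lemma deriv_inv f x a : f x != 0 -> is_derive x 1 f a ->
  is_derive x 1 (fun t => (f t)^-1) (- (f x) ^- 2 * a).
Proof.
move=> fx0 df.
exact: (@is_derive_eq _ _ _ (fun t => (f t)^-1) x 1 _ _ (is_deriveV fx0 df)).
Qed.

Lemma deriv_sum n (h : 'I_n -> R -> R) x (dh : 'I_n -> R) :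
  (forall i, is_derive x 1 (h i) (dh i)) ->
  is_derive x 1 (fun t => \sum_(i < n) h i t) (\sum_(i < n) dh i).
Proof.
move=> dhi; have -> : (fun t => \sum_(i < n) h i t) = \sum_(i < n) h i.
  by apply/funext => t; rewrite fct_sumE.
by apply: is_derive_sum => i; exact: dhi.
Qed.

Lemma der_continuous f x a : is_derive x 1 f a -> {for x, continuous f}.
Proof.
by move=> df; apply/differentiable_continuous/derivable1_diffP; case: df.
Qed.

End Calculus.

(** The tactics [der] and [der_eq] compute a derivative by recursion on the
expression: the value is an existential variable that the rules above fill in,
and [der_eq] leaves the comparison with the expected value as an equation. *)
Ltac der_step := first [apply: deriv_cst |
  lazymatch goal with
  | |- is_derive _ _ (GRing.mul _) _ => apply: deriv_scale
  | |- is_derive _ _ (GRing.opp) _ => apply: deriv_oppr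
  | |- is_derive _ _ sin _ => apply: is_derive_sin
  | |- is_derive _ _ cos _ => apply: is_derive_cos
  | |- is_derive _ _ expR _ => apply: is_derive_expR
  | |- is_derive _ _ (GRing.add _) _ => apply: deriv_shift
  | |- is_derive _ _ (fun t => t) _ => apply: deriv_id
  | |- is_derive _ _ (fun t => _ + _) _ => eapply deriv_add
  | |- is_derive _ _ (fun t => _ * _) _ => eapply deriv_mul
  | |- is_derive _ _ (fun t => - _) _ => eapply deriv_opp
  | |- is_derive _ _ (fun t => _ ^+ _) _ => eapply deriv_exprn
  | |- is_derive _ _ (fun t => sin _) _ =>
      eapply (@deriv_comp _ sin); first exact: is_derive_sin
  | |- is_derive _ _ (fun t => cos _) _ =>
      eapply (@deriv_comp _ cos); first exact: is_derive_cos
  | |- is_derive _ _ (fun t => expR _) _ =>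
      eapply (@deriv_comp _ expR); first exact: is_derive_expR
  | |- is_derive _ _ (fun t => (_)^-1) _ => eapply deriv_inv
  | |- is_derive _ _ (fun t => bigop.body _ _ _) _ => eapply deriv_sum; intro
  end].
Ltac der := repeat der_step.
Ltac der_eq := eapply is_derive_eq; [by der | cbv beta].

Section FTC.
Context {R : realType}.
Implicit Types (f g F : R -> R) (x t a b c : R).
Notation mu := (@lebesgue_measure R).

(** Every one-dimensional integral below is evaluated with an explicit
antiderivative, so this single form of the fundamental theorem suffices. The
interval is open because the sections of the triangle are. *)
Lemma integral_antiderivative F f a b : a < b ->
  (forall t, a <= t <= b -> is_derive t 1 F (f t)) ->
  (forall t, a <= t <= b -> {for t, continuous f}) ->
  (\int[mu]_(t in `]a, b[) (f t)%:E)%E = (F b - F a)%:E.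
Proof.
move=> ab dF cf.
have cw : {within `[a, b], continuous f}.
  by apply: continuous_in_subspaceT => t; rewrite inE /= in_itv /= => /cf.
rewrite -(@integral_itv_bndoo _ a b (EFin \o f) true false).
  rewrite EFinB; apply: continuous_FTC2 => //.
  - split.
    + move=> t; rewrite in_itv /= => /andP[ta tb].
      by have [] : is_derive t 1 F (f t) by apply: dF; rewrite !ltW.
    + apply: cvg_at_right_filter.
      by apply: der_continuous (dF a _); rewrite lexx ltW.
    + apply: cvg_at_left_filter.
      by apply: der_continuous (dF b _); rewrite lexx ltW.
  - move=> t; rewrite in_itv /= => /andP[ta tb].
    have := dF t; rewrite !ltW// => /(_ isT) => dFt.
    by rewrite derive1E; apply: derive_val.
apply/measurable_EFinP; apply: subspace_continuous_measurable_fun => //.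
by apply: continuous_subspaceW cw; exact: subset_itv_oo_cc.
Qed.

(** The increment is the integral of the derivative. *)
Lemma der_nondecreasing F f a b : a <= b ->
  (forall t, a <= t <= b -> is_derive t 1 F (f t)) ->
  (forall t, a <= t <= b -> {for t, continuous f}) ->
  (forall t, a <= t <= b -> 0 <= f t) -> F a <= F b.
Proof.
rewrite le_eqVlt => /predU1P[-> //|ab] dF cf f0.
rewrite -subr_ge0 -lee_fin -(integral_antiderivative _ _ _ _ ab dF cf).
apply: integral_ge0 => t /=; rewrite in_itv /= => /andP[ta tb].
by rewrite lee_fin f0// !ltW.
Qed.


End FTC.

(** * Measurability in the plane *)

Section Plane.
Context {R : realType}.
Notation RR := (measurableTypeR R).
Implicit Types (q x y : R) (f g : R * R -> R).

Lemma cvg_plane (T : Type) (F : set_system T) {FF : Filter F} (u v : T -> R)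
    (a b : R) f : continuous f -> u @ F --> a -> v @ F --> b ->
  f (u t, v t) @[t --> F] --> f (a, b).
Proof.
move=> cf ua vb; apply: (@continuous_cvg _ _ _ F _ (fun t => (u t, v t)) f (a, b)).
  exact: cf.
exact: (@cvg_pair _ _ _ F (nbhs a) (nbhs b) _ _ _ u v ua vb).
Qed.

(** The product sigma-algebra is generated by rectangles and not by open
sets, so f is written as the pointwise limit of functions that are step
functions of x for fixed y: such a function is measurable because f(c, .) is
continuous for each of the countably many grid values c of x. *)
Lemma continuous_measurable_plane f :
  continuous f -> measurable_fun [set: RR * RR] f.
Proof.
move=> cf.
(* The grid point of mesh 1 / (n + 1) to the left of t. *)
pose d (n : nat) (t : R) : R := (Num.floor (t * n.+1%:R))%:~R / n.+1%:R.
apply: (@measurable_fun_cvg _ _ _ _ (fun n z => f (d n z.1, z.2))).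
- move=> n _ Y mY; rewrite setTI.
  have -> : (fun z : RR * RR => f (d n z.1, z.2)) @^-1` Y =
    \bigcup_(k in [set: int]) ((fst @^-1` `[k%:~R / n.+1%:R, (k + 1)%:~R / n.+1%:R[)
       `&` (snd @^-1` ((fun y => f (k%:~R / n.+1%:R, y)) @^-1` Y))).
    apply/seteqP; split => [[x y] /= Yf|[x y] [k _] /=].
      exists (Num.floor (x * n.+1%:R)) => //=; split => //.
      rewrite in_itv /= ler_pdivrMr// ltr_pdivlMr//.
      exact: floor_itv.
    rewrite in_itv /= ler_pdivrMr// ltr_pdivlMr// => -[xk Yf].
    by rewrite /d (floor_def xk).
  apply: countable_bigcupT_measurable => [|k]; first exact: countableP.
  apply: measurableI.
    rewrite -[X in measurable X]setTI.
    by apply: measurable_fst => //; exact: measurable_itv.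
  rewrite -[X in measurable X]setTI; apply: measurable_snd => //.
  rewrite -[X in measurable X]setTI.
  apply: (@continuous_measurable_fun R (fun y => f (k%:~R / n.+1%:R, y))) => //.
  by move=> y; apply: cvg_plane => //; exact: cvg_cst.
- move=> [x y] _ /=.
  apply: (cvg_plane _ _ (fun n => d n x) (fun=> y)) => //; last exact: cvg_cst.
  apply/cvgrPdist_le => e e0; near=> n.
  have n0 : 0 < n.+1%:R :> R by [].
  have /andP[fl fu] := floor_itv (x * n.+1%:R).
  have ne : n.+1%:R^-1 < e by near: n; exact: (near_infty_natSinv_lt (PosNum e0)).
  rewrite ger0_norm /d.
    apply: le_trans (ltW ne).
    by rewrite lerBlDr -{1}[n.+1%:R^-1]mul1r -mulrDl ler_pdivlMr// addrC -intrD1 ltW.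
  by rewrite subr_ge0 ler_pdivrMr.
Unshelve. all: by end_near. Qed.


Lemma measurable_triangle q : measurable (triangle q : set (RR * RR)).
Proof.
have cont1 : continuous (fst : R * R -> R) by move=> z; exact: cvg_fst.
have cont2 : continuous (snd : R * R -> R) by move=> z; exact: cvg_snd.
have mh (h : R * R -> R) : continuous h ->
    measurable ([set z | 0 < h z] : set (RR * RR)).
  move=> ch; have := continuous_measurable_plane h ch.
  move=> /(_ measurableT `]0, +oo[%classic (measurable_itv _)); rewrite setTI.
  congr measurable; apply/seteqP; split=> z /=; by rewrite in_itv /= andbT.
have -> : (triangle q : set (RR * RR)) = ([set z | 0 < z.1] `&` [set z | 0 < q - z.1])
   `&` ([set z | 0 < z.2] `&` [set z | 0 < 1 - z.1 / q - z.2]).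
  apply/seteqP; split => z /=.
    by case=> *; rewrite !subr_gt0.
  by rewrite !subr_gt0 => -[[] ? ? []].
apply: measurableI; apply: measurableI; apply: mh => //.
- by move=> z; apply: cvgB; [exact: cvg_cst|exact: cont1].
- move=> z; apply: cvgB; last exact: cont2.
  apply: cvgB; first exact: cvg_cst.
  by apply: cvgM; [exact: cont1|exact: cvg_cst].
Qed.

End Plane.

(** * Iterated integrals and the divergence theorem on the triangle *)

Section Triangle.
Context {R : realType}.
Notation RR := (measurableTypeR R).
Notation mu := (@lebesgue_measure R).
Implicit Types (q x y : R) (f g : R * R -> R).

Lemma triangle_measure q : 0 < q -> ((leb2 R) (triangle q) < +oo)%E.
Proof.
move=> q0.
have sub : (triangle q : set (RR * RR)) `<=` `]0, q[ `*` `]0, 1[.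
  move=> z [z1 z1q z2 z2l]; split => /=; rewrite in_itv /=; apply/andP; split => //.
  by apply: lt_trans z2l _; rewrite gtrBl divr_gt0.
apply: (@le_lt_trans _ _ ((leb2 R) (`]0, q[ `*` `]0, 1[))).
  by apply: le_measure => //; rewrite inE; [exact: measurable_triangle|
    apply: measurableX; exact: measurable_itv].
rewrite product_measure1E; [|exact: measurable_itv..].
have : (mu `]0%R, q[%classic * mu `]0%R, 1%R[%classic < +oo)%E; last by [].
by rewrite !lebesgue_measure_itv /= !lte_fin q0 ltr01 -EFinM ltry.
Qed.

Lemma integral_section1 q f x : 0 < q ->
  (\int[mu]_y ((EFin \o f) \_ (triangle q : set (RR * RR))) (x, y) =
   ((fun x => \int[mu]_(y in `]0%R, (1 - x / q)%R[) (f (x, y))%:E)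
      \_ (`]0%R, q[%classic)) x)%E.
Proof.
move=> q0; rewrite [RHS]patchE.
case: ifPn => [|]; rewrite ?inE ?notin_setE /= in_itv /= => xq.
  rewrite [RHS]integral_mkcond; apply: eq_integral => y _; rewrite !patchE.
  suff -> : ((x, y) \in (triangle q : set (RR * RR))) =
    (y \in `]0, (1 - x / q)%R[%classic) by [].
  apply/idP/idP; rewrite !inE /triangle /= in_itv /=.
    by case=> _ _ -> ->.
  by case/andP: xq => ? ? /andP[].
apply: integral0_eq => y _; rewrite patchE ifF//; apply/negbTE.
by rewrite notin_setE => -[/= x0 x1 _ _]; apply: xq; rewrite x0.
Qed.

Lemma fubini1 q f : 0 < q -> (leb2 R).-integrable (triangle q) (EFin \o f) ->
  (\int[leb2 R]_(z in triangle q) (f z)%:E =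
   \int[mu]_(x in `]0%R, q[)
     \int[mu]_(y in `]0%R, (1 - x / q)%R[) (f (x, y))%:E)%E.
Proof.
move=> q0 /integrable_mkcond => /(_ (measurable_triangle q)) intf.
rewrite integral_mkcond -integral12_prod_meas1// [RHS]integral_mkcond.
by apply: eq_integral => x _; exact: integral_section1.
Qed.

Lemma fubini2 q f : 0 < q -> (leb2 R).-integrable (triangle q) (EFin \o f) ->
  (\int[leb2 R]_(z in triangle q) (f z)%:E =
   \int[mu]_(y in `]0%R, 1%R[) \int[mu]_(x in `]0%R, (q * (1 - y))%R[) (f (x, y))%:E)%E.
Proof.
move=> q0 /integrable_mkcond => /(_ (measurable_triangle q)) intf.
rewrite integral_mkcond -integral21_prod_meas1// [RHS]integral_mkcond.
have E x y : (y < 1 - x / q) = (x < q * (1 - y)).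
  by rewrite ltrBrDl -ltrBrDr ltr_pdivrMr// mulrC.
apply: eq_integral => y _; rewrite /fubini_G patchE.
case: ifPn => [|]; rewrite ?inE ?notin_setE /= in_itv /= => yq.
  rewrite [RHS]integral_mkcond; apply: eq_integral => x _; rewrite !patchE.
  suff -> : ((x, y) \in (triangle q : set (RR * RR))) = (x \in `]0, (q * (1 - y))%R[%classic) by [].
  apply/idP/idP; rewrite !inE /triangle /= in_itv /=.
    by case=> -> _ _; rewrite E.
  case/andP: yq => y0 y1 /andP[x0 xq]; split => //; last by rewrite E.
  by apply: lt_trans xq _; rewrite -subr_gt0 mulrBr mulr1 opprB addrC subrK mulr_gt0.
apply: integral0_eq => x _; rewrite patchE ifF//; apply/negbTE.
rewrite notin_setE => -[/= x0 x1 y0]; rewrite E => xq; apply: yq.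
rewrite y0 /=; have := lt_trans x0 xq; rewrite pmulr_rgt0// subr_gt0//.
Qed.

(** Boundedness and measurability on the triangle are stable under all the
operations used below and imply integrability of any power, the triangle having
finite measure; the singularity of the fields below at the vertex B is harmless
in this class. *)
Definition bmeas q f := measurable_fun (triangle q : set (RR * RR)) f /\
  exists M, forall z, triangle q z -> `|f z| <= M.

Lemma bmeas_integrable q f : 0 < q -> bmeas q f ->
  (leb2 R).-integrable (triangle q) (EFin \o f).
Proof.
move=> q0 [mf [M fM]]; apply: measurable_bounded_integrable => //.
- exact: measurable_triangle.
- exact: triangle_measure.
- exists `|M|; split; first exact: num_real.
  by move=> N MN z /= /fM fz; apply: le_trans fz (le_trans (ler_norm _) (ltW MN)).
Qed.

Lemma bmeas_add q f g : bmeas q f -> bmeas q g -> bmeas q (fun z => f z + g z).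
Proof.
move=> [mf [M fM]] [mg [N gN]]; split; first exact: measurable_funD.
exists (M + N) => z Uz; apply: le_trans (ler_normD _ _) _.
by apply: lerD; [exact: fM|exact: gN].
Qed.

Lemma bmeas_mul q f g : bmeas q f -> bmeas q g -> bmeas q (fun z => f z * g z).
Proof.
move=> [mf [M fM]] [mg [N gN]]; split; first exact: measurable_funM.
exists (M * N) => z Uz; rewrite normrM.
by apply: ler_pM => //; [exact: fM|exact: gN].
Qed.

Lemma bmeas_cst q c : bmeas q (fun=> c).
Proof. by split => //; exists `|c|. Qed.

Lemma bmeas_opp q f : bmeas q f -> bmeas q (fun z => - f z).
Proof.
move=> [mf [M fM]]; split; first exact: measurable_funN.
by exists M => z Uz; rewrite normrN; exact: fM.
Qed.

Lemma bmeas_exprn q f n : bmeas q f -> bmeas q (fun z => f z ^+ n).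
Proof.
move=> nf; elim: n => [|n IHn]; first exact: bmeas_cst.
by under eq_fun do rewrite exprS; exact: bmeas_mul.
Qed.

Lemma bmeas_sum q n (h : 'I_n -> R * R -> R) : (forall i, bmeas q (h i)) ->
  bmeas q (fun z => \sum_(i < n) h i z).
Proof.
elim: n h => [|n IHn] h hn.
  by under eq_fun do rewrite big_ord0; exact: bmeas_cst.
by under eq_fun do rewrite big_ord_recr; apply: bmeas_add => //; exact: IHn.
Qed.

Lemma bmeas_continuous q f : 0 < q -> continuous f -> bmeas q f.
Proof.
move=> q0 cf; split.
  by apply: measurable_funTS; exact: continuous_measurable_plane.
have cpt : compact (`[0, q] `*` `[0, 1] : set (R * R)).
  by apply: compact_setX; exact: segment_compact.
have := compact_bounded (continuous_compact (continuous_subspaceT cf) cpt).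
move=> [M [_ /(_ (M + 1))]]; rewrite ltrDl ltr01 => /(_ isT) fM.
exists (M + 1) => z [z1 z1q z2 z2l]; apply: fM; exists z => //.
split => /=; rewrite in_itv /= !ltW//=.
by apply: lt_trans z2l _; rewrite gtrBl divr_gt0.
Qed.

Lemma continuous_integrable_oo (g : R -> R) a b :
  (forall t, a <= t <= b -> {for t, continuous g}) ->
  mu.-integrable `]a, b[ (EFin \o g).
Proof.
move=> cg.
have intc : mu.-integrable `[a, b] (EFin \o g).
  apply: continuous_compact_integrable; first exact: segment_compact.
  by apply: continuous_in_subspaceT => t; rewrite inE /= in_itv /= => /cg.
by apply: integrableS intc => //; exact: subset_itv_oo_cc.
Qed.

(** The inner integral is a parameter because it is always known in closed
form; its integrability in x then comes for free from Fubini's theorem. *)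
Lemma fubini1_eq q f (g : R -> R) : 0 < q -> bmeas q f ->
  (forall x, 0 < x < q ->
    (\int[mu]_(y in `]0%R, (1 - x / q)%R[) (f (x, y))%:E = (g x)%:E)%E) ->
  mu.-integrable `]0, q[ (EFin \o g) /\
  \int[leb2 R]_(z in triangle q) f z = \int[mu]_(x in `]0, q[) g x.
Proof.
move=> q0 nf fg; have intf := bmeas_integrable _ _ q0 nf.
split; last first.
  rewrite /Rintegral fubini1//; congr fine; apply: eq_integral => x.
  by rewrite inE /= in_itv /=; exact: fg.
apply/integrable_mkcond; first exact: measurable_itv.
have /integrable_mkcond := intf => /(_ (measurable_triangle q)) /integrable_fubini_F.
congr (mu.-integrable _ _); apply/funext => x; rewrite /fubini_F.
rewrite integral_section1// !patchE; case: ifPn => //.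
by rewrite inE /= in_itv /=; exact: fg.
Qed.

Lemma fubini2_eq q f (g : R -> R) : 0 < q -> bmeas q f ->
  (forall y, 0 < y < 1 ->
    (\int[mu]_(x in `]0%R, (q * (1 - y))%R[) (f (x, y))%:E = (g y)%:E)%E) ->
  \int[leb2 R]_(z in triangle q) f z = \int[mu]_(y in `]0, 1[) g y.
Proof.
move=> q0 nf fg; have intf := bmeas_integrable _ _ q0 nf.
rewrite /Rintegral fubini2//; congr fine; apply: eq_integral => x.
by rewrite inE /= in_itv /=; exact: fg.
Qed.

(** The form in which energies are bounded: integrate exactly in y, bound the
result by a function of x with a known antiderivative. *)
Lemma fubini1_le q f (g B dB : R -> R) : 0 < q -> bmeas q f ->
  (forall x, 0 < x < q ->
    (\int[mu]_(y in `]0%R, (1 - x / q)%R[) (f (x, y))%:E = (g x)%:E)%E) ->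
  (forall x, 0 < x < q -> g x <= dB x) ->
  (forall x, is_derive x 1 B (dB x)) -> continuous dB ->
  \int[leb2 R]_(z in triangle q) f z <= B q - B 0.
Proof.
move=> q0 nf fg gB derB cB; have [intg ->] := fubini1_eq _ _ _ q0 nf fg.
apply: (@le_trans _ _ (\int[mu]_(x in `]0, q[) dB x)).
  apply: le_Rintegral => //.
  by apply: continuous_integrable_oo => t _; exact: cB.
rewrite /Rintegral (integral_antiderivative B) ?lexx//.
by move=> t _; exact: cB.
Qed.

Lemma green1 q (F D : R * R -> R) : 0 < q -> bmeas q D ->
  (forall x y, 0 < y < 1 -> 0 <= x <= q * (1 - y) ->
    is_derive x 1 (fun t => F (t, y)) (D (x, y))) ->
  (forall x y, 0 < y < 1 -> 0 <= x <= q * (1 - y) ->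
    {for x, continuous (fun t => D (t, y))}) ->
  \int[leb2 R]_(z in triangle q) D z =
    \int[mu]_(y in `]0, 1[) (F (q * (1 - y), y) - F (0, y)).
Proof.
move=> q0 nD dF cD; apply: fubini2_eq => // y y01.
apply: (integral_antiderivative (fun t => F (t, y)) (fun t => D (t, y))).
- by case/andP: y01 => ? ?; rewrite mulr_gt0// subr_gt0.
- by move=> t; exact: dF.
- by move=> t; exact: cD.
Qed.

Lemma green2 q (F D : R * R -> R) : 0 < q -> bmeas q D ->
  (forall x y, 0 < x < q -> 0 <= y <= 1 - x / q ->
    is_derive y 1 (fun t => F (x, t)) (D (x, y))) ->
  (forall x y, 0 < x < q -> 0 <= y <= 1 - x / q ->
    {for y, continuous (fun t => D (x, t))}) ->
  \int[leb2 R]_(z in triangle q) D z =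
    \int[mu]_(x in `]0, q[) (F (x, 1 - x / q) - F (x, 0)).
Proof.
move=> q0 nD dF cD; apply: (fubini1_eq _ _ _ q0 nD _).2 => // x xq.
apply: (integral_antiderivative (fun t => F (x, t)) (fun t => D (x, t))).
- by case/andP: xq => ? ?; rewrite subr_gt0 ltr_pdivrMr// mul1r.
- by move=> t; exact: dF.
- by move=> t; exact: cD.
Qed.

(** The hypotenuse is parametrized by x in one of the two iterated integrals
and by y in the other. *)
Lemma integral_hypotenuse q (G : R -> R) : 0 < q -> continuous G ->
  \int[mu]_(x in `]0, q[) G x = \int[mu]_(y in `]0, 1[) (q * G (q * (1 - y))).
Proof.
move=> q0 cG; rewrite /Rintegral; congr fine.
pose F := fun y : R => q * (1 - y).
have dF y : is_derive y 1 F (- q) by rewrite /F; der_eq; ring.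
have F1E : derive1 F = fun=> - q by apply/funext => y; rewrite derive1E; apply: derive_val.
have cF y : {for y, continuous F} by exact: der_continuous (dF y).
have F0 : F 0 = q by rewrite /F subr0 mulr1.
have F1 : F 1 = 0 by rewrite /F subrr mulr0.
have := @integration_by_substitution_decreasing R F G 0 1 ler01.
rewrite F0 F1 F1E => sub.
rewrite -(@integral_itv_bndoo _ 0 q (EFin \o G) true false); last first.
  apply/measurable_EFinP; apply: measurable_funTS; exact: continuous_measurable_fun.
rewrite /= sub//.
- rewrite (@integral_itv_bndoo _ 0 1 _ true false).
    by apply: eq_integral => y _; rewrite !fctE /= opprK mulrC.
  apply/measurable_EFinP; apply: measurable_funTS; apply: continuous_measurable_fun.
  by move=> y; apply: cvgM; [apply: continuous_comp; [exact: cF|exact: cG]|exact: cvg_cst].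
- by move=> x y _ _ xy; rewrite /F ltr_pM2l// ltrD2l ltrN2.
- by move=> y _; exact: cvg_cst.
- exact: is_cvg_cst.
- exact: is_cvg_cst.
- split; first by move=> y _; case: (dF y).
  + by apply: cvg_at_right_filter; exact: cF.
  + by apply: cvg_at_left_filter; exact: cF.
- exact: continuous_subspaceT.
Qed.

(** The two components are integrated first along x and first along y. The
boundary terms on the hypotenuse cancel after the substitution x = q (1 - y),
since F1 + q F2, proportional to the flux through it, is 0; the one on AB vanishes with F2. The
derivatives are only required along chords that avoid the vertex B. *)
Lemma divergence_triangle q (F1 F2 D1 D2 : R * R -> R) (G : R -> R) :
  0 < q -> bmeas q D1 -> bmeas q D2 -> continuous G ->
  continuous (fun y => F1 (0, y)) ->
  (forall x y, 0 < y < 1 -> 0 <= x <= q * (1 - y) ->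
    is_derive x 1 (fun t => F1 (t, y)) (D1 (x, y))) ->
  (forall x y, 0 < y < 1 -> 0 <= x <= q * (1 - y) ->
    {for x, continuous (fun t => D1 (t, y))}) ->
  (forall x y, 0 < x < q -> 0 <= y <= 1 - x / q ->
    is_derive y 1 (fun t => F2 (x, t)) (D2 (x, y))) ->
  (forall x y, 0 < x < q -> 0 <= y <= 1 - x / q ->
    {for y, continuous (fun t => D2 (x, t))}) ->
  (forall x, 0 < x < q -> F2 (x, 0) = 0) ->
  (forall x, 0 < x < q -> F2 (x, 1 - x / q) = G x) ->
  (forall x, 0 < x < q -> F1 (x, 1 - x / q) = - q * G x) ->
  \int[leb2 R]_(z in triangle q) (D1 z + D2 z) =
    - \int[mu]_(y in `]0, 1[) F1 (0, y).
Proof.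
move=> q0 n1 n2 cG cF1 dF1 cD1 dF2 cD2 F20 F2G F1G.
rewrite RintegralD; [|exact: measurable_triangle|exact: bmeas_integrable..].
rewrite (green1 _ _ _ q0 n1 dF1 cD1) (green2 _ _ _ q0 n2 dF2 cD2).
under [X in _ + X]eq_Rintegral => x.
  rewrite inE /= in_itv /= => xq; rewrite F20// F2G// subr0; over.
under eq_Rintegral => y.
  rewrite inE /= in_itv /= => /andP[y0 y1].
  have := F1G (q * (1 - y)); have -> : 1 - q * (1 - y) / q = y.
    by field; rewrite gt_eqF.
  rewrite mulr_gt0 ?subr_gt0//= -subr_gt0.
  have -> : q - q * (1 - y) = q * y by ring.
  rewrite mulr_gt0// => /(_ isT) ->; over.
have cGq c : continuous (fun y => c * G (q * (1 - y))).
  move=> t; have dq : is_derive t 1 (fun y => q * (1 - y)) (- q) by der_eq; ring.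
  apply: cvgM; first exact: cvg_cst.
  exact: (continuous_comp (der_continuous _ _ _ dq) (cG _)).
rewrite integral_hypotenuse// -RintegralD//; first last.
- by apply: continuous_integrable_oo => t _; exact: cGq.
- apply: continuous_integrable_oo => t _; apply: cvgB; last exact: cF1.
  exact: cGq.
rewrite -[RHS]mulN1r -RintegralZl//; last first.
  by apply: continuous_integrable_oo => t _; exact: cF1.
by apply: eq_Rintegral => y _; ring.
Qed.

End Triangle.

(** * Smooth functions as members of the Sobolev space *)

Section Smooth.
Context {R : realType}.
Notation mu := (@lebesgue_measure R).
Implicit Types (q x y : R) (f g phi : R * R -> R).

Lemma partial1_eq f (d : R * R -> R) :
  (forall x y, is_derive x 1 (fun t => f (t, y)) (d (x, y))) -> partial1 f = d.
Proof.
move=> df; apply/funext => -[x y]; rewrite /partial1 /= derive1E.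
by have := df x y => dfx; apply: derive_val.
Qed.

Lemma partial2_eq f (d : R * R -> R) :
  (forall x y, is_derive y 1 (fun t => f (x, t)) (d (x, y))) -> partial2 f = d.
Proof.
move=> df; apply/funext => -[x y]; rewrite /partial2 /= derive1E.
by have := df x y => dfx; apply: derive_val.
Qed.

Lemma is_CkS k f : is_Ck k.+1 f ->
  [/\ continuous f,
    forall x y, is_derive x 1 (fun t => f (t, y)) (partial1 f (x, y)),
    forall x y, is_derive y 1 (fun t => f (x, t)) (partial2 f (x, y)),
    is_Ck k (partial1 f) & is_Ck k (partial2 f)].
Proof.
move=> [cf d1 d2 k1 k2]; split => // x y; apply: DeriveDef.
- exact: (d1 (x, y)).
- by rewrite /partial1 /= derive1E.
- exact: (d2 (x, y)).
- by rewrite /partial2 /= derive1E.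
Qed.

Lemma is_CkP k f (d1 d2 : R * R -> R) : continuous f ->
  (forall x y, is_derive x 1 (fun t => f (t, y)) (d1 (x, y))) ->
  (forall x y, is_derive y 1 (fun t => f (x, t)) (d2 (x, y))) ->
  is_Ck k d1 -> is_Ck k d2 -> is_Ck k.+1 f.
Proof.
move=> cf df1 df2 k1 k2 /=; rewrite (partial1_eq _ _ df1) (partial2_eq _ _ df2).
split => //.
Qed.

Lemma is_Ck_pred k f : is_Ck k.+1 f -> is_Ck k f.
Proof.
elim: k f => [|k IHk] f; first by case.
by move=> [cf d1 d2 k1 k2]; split => //; exact: IHk.
Qed.

Lemma is_Ck_cst k (c : R) : is_Ck k (fun=> c).
Proof.
elim: k c => [|k IHk] c; first by move=> z; exact: cvg_cst.
apply: (is_CkP _ _ (fun=> 0) (fun=> 0)) => //.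
- by move=> z; exact: cvg_cst.
- by move=> x y; der.
- by move=> x y; der.
Qed.

Lemma is_Ck_add k f g : is_Ck k f -> is_Ck k g -> is_Ck k (fun z => f z + g z).
Proof.
elim: k f g => [|k IHk] f g; first by move=> cf cg z; apply: cvgD; [exact: cf|exact: cg].
move=> /is_CkS[cf f1 f2 kf1 kf2] /is_CkS[cg g1 g2 kg1 kg2].
apply: (is_CkP _ _ (fun z => partial1 f z + partial1 g z)
  (fun z => partial2 f z + partial2 g z)).
- by move=> z; apply: cvgD; [exact: cf|exact: cg].
- exact: IHk.
- exact: IHk.
Qed.

Lemma is_Ck_mul k f g : is_Ck k f -> is_Ck k g -> is_Ck k (fun z => f z * g z).
Proof.
elim: k f g => [|k IHk] f g; first by move=> cf cg z; apply: cvgM; [exact: cf|exact: cg].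
move=> kf kg; have [cf f1 f2 kf1 kf2] := is_CkS _ _ kf.
have [cg g1 g2 kg1 kg2] := is_CkS _ _ kg.
apply: (is_CkP _ _ (fun z => partial1 f z * g z + f z * partial1 g z)
  (fun z => partial2 f z * g z + f z * partial2 g z)).
- by move=> z; apply: cvgM; [exact: cf|exact: cg].
- by move=> x y; apply: deriv_mul.
- by move=> x y; apply: deriv_mul.
- by apply: is_Ck_add; apply: IHk => //; exact: is_Ck_pred.
- by apply: is_Ck_add; apply: IHk => //; exact: is_Ck_pred.
Qed.

Lemma smooth_continuous f : smooth f -> continuous f.
Proof. by move=> sf; exact: (sf 0%N). Qed.

Lemma smooth_partial1 f : smooth f -> smooth (partial1 f).
Proof. by move=> sf k; case: (sf k.+1). Qed.

Lemma smooth_partial2 f : smooth f -> smooth (partial2 f).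
Proof. by move=> sf k; case: (sf k.+1). Qed.

Lemma smooth_der1 f x y : smooth f ->
  is_derive x 1 (fun t => f (t, y)) (partial1 f (x, y)).
Proof. by move=> sf; have [] := is_CkS _ _ (sf 1%N). Qed.

Lemma smooth_der2 f x y : smooth f ->
  is_derive y 1 (fun t => f (x, t)) (partial2 f (x, y)).
Proof. by move=> sf; have [] := is_CkS _ _ (sf 1%N). Qed.

Lemma smooth_cst (c : R) : smooth (fun=> c).
Proof. by move=> k; exact: is_Ck_cst. Qed.

Lemma smooth_add f g : smooth f -> smooth g -> smooth (fun z => f z + g z).
Proof. by move=> sf sg k; exact: is_Ck_add. Qed.

Lemma smooth_mul f g : smooth f -> smooth g -> smooth (fun z => f z * g z).
Proof. by move=> sf sg k; exact: is_Ck_mul. Qed.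

Lemma smooth_sum n (h : 'I_n -> R * R -> R) : (forall i, smooth (h i)) ->
  smooth (fun z => \sum_(i < n) h i z).
Proof.
elim: n h => [|n IHn] h sh.
  by under eq_fun do rewrite big_ord0; exact: smooth_cst.
by under eq_fun do rewrite big_ord_recr; apply: smooth_add => //; exact: IHn.
Qed.

(** A function of one variable is smooth as soon as it sits in a sequence of
functions each of which is the derivative of the previous one. *)
Lemma smooth_tower1 (g : nat -> R -> R) n :
  (forall m (t : R), is_derive t 1 (g m) (g m.+1 t)) -> smooth (fun z => g n z.1).
Proof.
move=> dg k; have cg m : continuous (fun z : R * R => g m z.1).
  move=> z; apply: (@continuous_comp _ _ _ fst (g m)); first exact: cvg_fst.
  exact: der_continuous (dg m z.1).
elim: k n => [|k IHk] n; first exact: cg.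
apply: (is_CkP _ _ (fun z => g n.+1 z.1) (fun=> 0)) => //.
- by move=> x y; exact: dg.
- by move=> x y /=; der.
- exact: is_Ck_cst.
Qed.

Lemma smooth_tower2 (g : nat -> R -> R) n :
  (forall m (t : R), is_derive t 1 (g m) (g m.+1 t)) -> smooth (fun z => g n z.2).
Proof.
move=> dg k; have cg m : continuous (fun z : R * R => g m z.2).
  move=> z; apply: (@continuous_comp _ _ _ snd (g m)); first exact: cvg_snd.
  exact: der_continuous (dg m z.2).
elim: k n => [|k IHk] n; first exact: cg.
apply: (is_CkP _ _ (fun=> 0) (fun z => g n.+1 z.2)) => //.
- by move=> x y /=; der.
- by move=> x y; exact: dg.
- exact: is_Ck_cst.
Qed.

Let id_tower (m : nat) (t : R) : R :=
  if m is m'.+1 then (m' == 0%N)%:R else t.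

Let der_id_tower m (t : R) : is_derive t 1 (id_tower m) (id_tower m.+1 t).
Proof. by case: m => [|m]; rewrite /id_tower /=; der. Qed.

Lemma smooth_fst : smooth (fun z : R * R => z.1).
Proof. exact: (smooth_tower1 id_tower 0 der_id_tower). Qed.

Lemma smooth_snd : smooth (fun z : R * R => z.2).
Proof. exact: (smooth_tower2 id_tower 0 der_id_tower). Qed.

Lemma smooth_expR1 (c : R) : smooth (fun z : R * R => expR (c * z.1)).
Proof.
have := smooth_tower1 (fun m t => c ^+ m * expR (c * t)) 0.
under eq_fun do rewrite expr0 mul1r; apply => m t; der_eq.
by rewrite exprS; ring.
Qed.

Lemma smooth_cos2 (c : R) : smooth (fun z : R * R => cos (c * z.2)).
Proof.
(* Each derivative translates the cosine by pi/2. *)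
have := smooth_tower2 (fun m t => c ^+ m * cos (c * t + m%:R * (pi / 2))) 0.
under eq_fun do rewrite expr0 mul1r mul0r addr0; apply => m t; der_eq.
have -> : c * t + m.+1%:R * (pi / 2) = c * t + m%:R * (pi / 2) + pi / 2 :> R.
  by rewrite -natr1; ring.
by rewrite cosDpihalf [c ^+ m.+1]exprS; ring.
Qed.

(** The field (s1, s2) has divergence d, no flux through AB and BC, and first
component s on AC, where the outward normal is (-1, 0). Stated as Green's
formula, this is linear in all four data and asks for no derivatives of the
field. *)
Definition flux_free q (s1 s2 d : R * R -> R) (s : R -> R) :=
  [/\ bmeas q s1, bmeas q s2, bmeas q d, continuous s &
    forall phi, smooth phi ->
      \int[leb2 R]_(z in triangle q)
         (s1 z * partial1 phi z + s2 z * partial2 phi z + d z * phi z)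
      = - \int[mu]_(y in `]0, 1[) (phi (0%R, y) * s y)].

Lemma flux_freeI q (s1 s2 d1 d2 : R * R -> R) (G : R -> R) :
  0 < q -> bmeas q s1 -> bmeas q s2 -> bmeas q d1 -> bmeas q d2 -> continuous G ->
  continuous (fun y => s1 (0, y)) ->
  (forall x y, 0 < y < 1 -> 0 <= x <= q * (1 - y) ->
    is_derive x 1 (fun t => s1 (t, y)) (d1 (x, y))) ->
  (forall x y, 0 < y < 1 -> 0 <= x <= q * (1 - y) ->
    {for x, continuous (fun t => d1 (t, y))}) ->
  (forall x y, 0 < x < q -> 0 <= y <= 1 - x / q ->
    is_derive y 1 (fun t => s2 (x, t)) (d2 (x, y))) ->
  (forall x y, 0 < x < q -> 0 <= y <= 1 - x / q ->
    {for y, continuous (fun t => d2 (x, t))}) ->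
  (forall x, 0 < x < q -> s2 (x, 0) = 0) ->
  (forall x, 0 < x < q -> s2 (x, 1 - x / q) = G x) ->
  (forall x, 0 < x < q -> s1 (x, 1 - x / q) = - q * G x) ->
  flux_free q s1 s2 (fun z => d1 z + d2 z) (fun y => s1 (0, y)).
Proof.
move=> q0 ns1 ns2 nd1 nd2 cG cs1 ds1 cd1 ds2 cd2 s20 s2G s1G; split => //.
  exact: bmeas_add.
move=> phi sphi.
have np : bmeas q phi by apply: bmeas_continuous => //; exact: smooth_continuous.
have np1 : bmeas q (partial1 phi).
  by apply: bmeas_continuous => //; exact/smooth_continuous/smooth_partial1.
have np2 : bmeas q (partial2 phi).
  by apply: bmeas_continuous => //; exact/smooth_continuous/smooth_partial2.
transitivity (\int[leb2 R]_(z in triangle q)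
    ((partial1 phi z * s1 z + phi z * d1 z)
     + (partial2 phi z * s2 z + phi z * d2 z))).
  by apply: eq_Rintegral => z _; ring.
apply: (divergence_triangle q (fun z => phi z * s1 z) (fun z => phi z * s2 z)
  (fun z => partial1 phi z * s1 z + phi z * d1 z)
  (fun z => partial2 phi z * s2 z + phi z * d2 z)
  (fun x => phi (x, 1 - x / q) * G x) q0).
- by apply: bmeas_add; apply: bmeas_mul.
- by apply: bmeas_add; apply: bmeas_mul.
- move=> x; apply: cvgM; last exact: cG.
  have dl : is_derive x 1 (fun x => 1 - x / q) (- q^-1) by der_eq; ring.
  apply: cvg_plane; first exact: smooth_continuous.
  + exact: cvg_id.
  + exact: der_continuous dl.
- move=> y; apply: cvgM; last exact: cs1.
  by apply: der_continuous (smooth_der2 phi 0 y sphi).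
- move=> x y y01 xl; apply: deriv_mul; first exact: smooth_der1.
  exact: ds1.
- move=> x y y01 xl; apply: cvgD; apply: cvgM.
  + exact: der_continuous (smooth_der1 _ x y (smooth_partial1 _ sphi)).
  + exact: der_continuous (ds1 x y y01 xl).
  + exact: der_continuous (smooth_der1 _ x y sphi).
  + exact: cd1.
- move=> x y y01 xl; apply: deriv_mul; first exact: smooth_der2.
  exact: ds2.
- move=> x y y01 xl; apply: cvgD; apply: cvgM.
  + exact: der_continuous (smooth_der2 _ x y (smooth_partial2 _ sphi)).
  + exact: der_continuous (ds2 x y y01 xl).
  + exact: der_continuous (smooth_der2 _ x y sphi).
  + exact: cd2.
- by move=> x xq; rewrite s20// mulr0.
- by move=> x xq; rewrite s2G.
- by move=> x xq; rewrite s1G//; ring.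
Qed.

Lemma bmeas_square_integrable q f : 0 < q -> bmeas q f ->
  square_integrable (triangle q) f.
Proof.
move=> q0 nf; split; first by case: nf.
exact: (bmeas_integrable _ _ q0 (bmeas_exprn _ _ 2 nf)).
Qed.

(** The divergence theorem for f phi: a test function vanishes on the three
sides, as they lie outside the open triangle. *)
Lemma smooth_weak_gradient q f : 0 < q -> smooth f ->
  weak_gradient (triangle q) f (partial1 f) (partial2 f).
Proof.
move=> q0 sf phi [sphi [K [_ KU phi0]]].
have phi00 z : ~ triangle q z -> phi z = 0.
  by move=> nUz; apply: phi0 => /KU.
have nf : bmeas q f by apply: bmeas_continuous => //; exact: smooth_continuous.
have nf1 : bmeas q (partial1 f).
  by apply: bmeas_continuous => //; exact/smooth_continuous/smooth_partial1.
have nf2 : bmeas q (partial2 f).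
  by apply: bmeas_continuous => //; exact/smooth_continuous/smooth_partial2.
have np : bmeas q phi by apply: bmeas_continuous => //; exact: smooth_continuous.
have np1 : bmeas q (partial1 phi).
  by apply: bmeas_continuous => //; exact/smooth_continuous/smooth_partial1.
have np2 : bmeas q (partial2 phi).
  by apply: bmeas_continuous => //; exact/smooth_continuous/smooth_partial2.
have left0 y : phi (0, y) = 0 by apply: phi00 => -[] /=; rewrite ltxx.
have bot0 x : phi (x, 0) = 0 by apply: phi00 => -[] /=; rewrite ltxx.
have hyp0 x : phi (x, 1 - x / q) = 0 by apply: phi00 => -[] /=; rewrite ltxx.
have mU := measurable_triangle q.
split.
- apply/eqP; rewrite -subr_eq0 opprK addrC -RintegralD//; last 2 first.
  + by apply: bmeas_integrable => //; exact: bmeas_mul.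
  + by apply: bmeas_integrable => //; exact: bmeas_mul.
  apply/eqP; under eq_Rintegral do rewrite -[_ + _]addr0.
  apply: etrans; first apply: (divergence_triangle q (fun z => f z * phi z) (fun=> 0)
    (fun z => partial1 f z * phi z + f z * partial1 phi z) (fun=> 0) (fun=> 0) q0) => //.
  + by apply: bmeas_add; apply: bmeas_mul.
  + exact: bmeas_cst.
  + by move=> x; exact: cvg_cst.
  + by under eq_fun do rewrite left0 mulr0; move=> x; exact: cvg_cst.
  + by move=> x y _ _; apply: deriv_mul; exact: smooth_der1.
  + move=> x y _ _; apply: cvgD; apply: cvgM.
    * exact: der_continuous (smooth_der1 _ x y (smooth_partial1 _ sf)).
    * exact: der_continuous (smooth_der1 _ x y sphi).
    * exact: der_continuous (smooth_der1 _ x y sf).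
    * exact: der_continuous (smooth_der1 _ x y (smooth_partial1 _ sphi)).
  + by move=> x y _ _; der.
  + by move=> x y _ _; exact: cvg_cst.
  + by move=> x _; rewrite hyp0 !mulr0.
  + under eq_Rintegral do rewrite left0 mulr0.
    by rewrite Rintegral_cst// mul0r oppr0.
- apply/eqP; rewrite -subr_eq0 opprK addrC -RintegralD//; last 2 first.
  + by apply: bmeas_integrable => //; exact: bmeas_mul.
  + by apply: bmeas_integrable => //; exact: bmeas_mul.
  apply/eqP; under eq_Rintegral do rewrite -[_ + _]add0r.
  apply: etrans; first apply: (divergence_triangle q (fun=> 0) (fun z => f z * phi z)
    (fun=> 0) (fun z => partial2 f z * phi z + f z * partial2 phi z) (fun=> 0) q0) => //.
  + exact: bmeas_cst.
  + by apply: bmeas_add; apply: bmeas_mul.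
  + by move=> x; exact: cvg_cst.
  + by move=> x; exact: cvg_cst.
  + by move=> x y _ _; der.
  + by move=> x y _ _; exact: cvg_cst.
  + by move=> x y _ _; apply: deriv_mul; exact: smooth_der2.
  + move=> x y _ _; apply: cvgD; apply: cvgM.
    * exact: der_continuous (smooth_der2 _ x y (smooth_partial2 _ sf)).
    * exact: der_continuous (smooth_der2 _ x y sphi).
    * exact: der_continuous (smooth_der2 _ x y sf).
    * exact: der_continuous (smooth_der2 _ x y (smooth_partial2 _ sphi)).
  + by move=> x _; rewrite bot0 mulr0.
  + by move=> x _; rewrite hyp0 mulr0.
  + by move=> x _; rewrite mulr0.
  + by rewrite Rintegral_cst// mul0r oppr0.
Qed.

Lemma smooth_H1_zero_on q f : 0 < q -> smooth f ->
  (forall z, sideAC z -> f z = 0) ->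
  H1_zero_on (triangle q) sideAC f (partial1 f) (partial2 f).
Proof.
move=> q0 sf f0; split.
  split; last exact: smooth_weak_gradient.
  - by apply: bmeas_square_integrable => //; apply: bmeas_continuous => //;
      exact: smooth_continuous.
  - by apply: bmeas_square_integrable => //; apply: bmeas_continuous => //;
      exact/smooth_continuous/smooth_partial1.
  - by apply: bmeas_square_integrable => //; apply: bmeas_continuous => //;
      exact/smooth_continuous/smooth_partial2.
move=> e e0; exists f; split => //.
rewrite (eq_integral (fun=> 0%E)) => [|z _]; first by rewrite integral0 lte_fin exprn_gt0.
by rewrite !subrr !expr0n /= !addr0.
Qed.

End Smooth.

(** * The two variational principles *)

Section Variational.
Context {R : realType}.
Implicit Types (q x y : R) (f g phi : R * R -> R).

Definition integrable_on q f := (leb2 R).-integrable (triangle q) (EFin \o f).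

Lemma integrable_on_add q f g : integrable_on q f -> integrable_on q g ->
  integrable_on q (fun z => f z + g z).
Proof. by move=> sf sg; have := integrableD (measurable_triangle q) sf sg. Qed.

Lemma integrable_on_scale q f (c : R) : integrable_on q f -> integrable_on q (fun z => c * f z).
Proof. by move=> sf; have := integrableZl (measurable_triangle q) c sf. Qed.

Lemma integrable_on_opp q f : integrable_on q f -> integrable_on q (fun z => - f z).
Proof.
move=> /(integrable_on_scale _ _ (-1)).
by under [X in integrable_on q X -> _]eq_fun do rewrite mulN1r.
Qed.

Lemma l2_mul q f g : square_integrable (triangle q) f ->
  square_integrable (triangle q) g -> integrable_on q (fun z => f z * g z).
Proof.
move=> [mf f2] [mg g2].
apply: le_integrable (integrable_on_add q _ _ f2 g2); first exact: measurable_triangle.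
  by apply/measurable_EFinP; exact: measurable_funM.
move=> z _ /=; rewrite lee_fin [leRHS]ger0_norm; last by rewrite addr_ge0 ?sqr_ge0.
have := sqr_ge0 (f z - g z); have := sqr_ge0 (f z + g z).
by move=> h1 h2; rewrite ler_norml; apply/andP; split; nra.
Qed.

Lemma l2_sub q f g : square_integrable (triangle q) f ->
  square_integrable (triangle q) g ->
  square_integrable (triangle q) (fun z => f z - g z).
Proof.
move=> sf sg; split; first by apply: measurable_funB; [case: sf|case: sg].
have [[_ f2] [_ g2]] := (sf, sg).
have := integrable_on_add q _ _ (integrable_on_add q _ _ f2 g2)
  (integrable_on_scale q _ (-2) (l2_mul q f g sf sg)).
by congr (_ .-integrable _ _); apply/funext => z /=; congr EFin; ring.
Qed.

Lemma Rint_add q f g : integrable_on q f -> integrable_on q g ->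
  \int[leb2 R]_(z in triangle q) (f z + g z) =
  \int[leb2 R]_(z in triangle q) f z + \int[leb2 R]_(z in triangle q) g z.
Proof. by move=> sf sg; rewrite RintegralD//; exact: measurable_triangle. Qed.

Lemma Rint_scale q f (c : R) : integrable_on q f ->
  \int[leb2 R]_(z in triangle q) (c * f z) =
  c * \int[leb2 R]_(z in triangle q) f z.
Proof. by move=> sf; rewrite RintegralZl//; exact: measurable_triangle. Qed.

Lemma Rint_le q f g : integrable_on q f -> integrable_on q g ->
  (forall z, triangle q z -> f z <= g z) ->
  \int[leb2 R]_(z in triangle q) f z <= \int[leb2 R]_(z in triangle q) g z.
Proof. by move=> sf sg fg; apply: le_Rintegral => //; exact: measurable_triangle. Qed.

Lemma smooth_bmeas q f : 0 < q -> smooth f ->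
  [/\ bmeas q f, bmeas q (partial1 f) & bmeas q (partial2 f)].
Proof.
move=> q0 sf; split; apply: bmeas_continuous => //; apply: smooth_continuous => //.
  exact: smooth_partial1.
exact: smooth_partial2.
Qed.

(** Dirichlet's principle. Testing the weak equation with u and with v shows
that the difference of the two members is the integral of |grad u - grad v|^2. *)
Lemma torsion_ge q u v : 0 < q -> weak_solution (triangle q) sideAC u ->
  smooth v -> (forall z, sideAC z -> v z = 0) ->
  2 * \int[leb2 R]_(z in triangle q) v z
  - \int[leb2 R]_(z in triangle q) (partial1 v z ^+ 2 + partial2 v z ^+ 2)
  <= \int[leb2 R]_(z in triangle q) u z.
Proof.
move=> q0 [g1 [g2 [Hu weak]]] sv v0.
have [[_ l1 l2 _] _] := Hu.
have [nv nv1 nv2] := smooth_bmeas q v q0 sv.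
have /(bmeas_square_integrable _ _ q0) lv1 := nv1.
have /(bmeas_square_integrable _ _ q0) lv2 := nv2.
have <- := weak _ _ _ Hu.
have <- := weak _ _ _ (smooth_H1_zero_on q v q0 sv v0).
have sgg : integrable_on q (fun z => g1 z * g1 z + g2 z * g2 z).
  by apply: integrable_on_add; exact: l2_mul.
have sgv : integrable_on q (fun z => g1 z * partial1 v z + g2 z * partial2 v z).
  by apply: integrable_on_add; exact: l2_mul.
have svv : integrable_on q (fun z => partial1 v z ^+ 2 + partial2 v z ^+ 2).
  by apply: integrable_on_add; [case: lv1|case: lv2].
rewrite lerBlDr -Rint_scale// -Rint_add//; apply: Rint_le => //.
- exact: integrable_on_scale.
- exact: integrable_on_add.
- move=> z _.
  have := sqr_ge0 (g1 z - partial1 v z); have := sqr_ge0 (g2 z - partial2 v z).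
  nra.
Qed.

(** Thomson's principle. The hypothesis says that (s1, s2) has divergence -1 in
the weak sense. If u were smooth, it would equate the integrals of s . grad u
and of u, and then the difference of the members is the integral of |s - grad u|^2. As u is
only a limit of smooth functions vanishing on AC, the estimate is made with a
smooth approximant and loses an arbitrarily small amount. *)
Lemma torsion_le q u (s1 s2 : R * R -> R) :
  0 < q -> weak_solution (triangle q) sideAC u ->
  bmeas q s1 -> bmeas q s2 ->
  (forall v, smooth v -> (forall z, sideAC z -> v z = 0) ->
    \int[leb2 R]_(z in triangle q)
      (s1 z * partial1 v z + s2 z * partial2 v z - v z) = 0) ->
  \int[leb2 R]_(z in triangle q) u z
    <= \int[leb2 R]_(z in triangle q) (s1 z ^+ 2 + s2 z ^+ 2).
Proof.
move=> q0 [g1 [g2 [Hu weak]]] ns1 ns2 divs.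
have [[lu l1 l2 _] approx] := Hu.
have /(bmeas_square_integrable _ _ q0) ls1 := ns1.
have /(bmeas_square_integrable _ _ q0) ls2 := ns2.
have l11 := bmeas_square_integrable q _ q0 (bmeas_cst q 1).
have mainT := weak _ _ _ Hu.
have sgg : integrable_on q (fun z => g1 z * g1 z + g2 z * g2 z).
  by apply: integrable_on_add; exact: l2_mul.
have sss : integrable_on q (fun z => s1 z ^+ 2 + s2 z ^+ 2).
  by apply: integrable_on_add; [case: ls1|case: ls2].
have su : integrable_on q u.
  by have := l2_mul _ _ _ lu l11; under eq_fun do rewrite mulr1.
set S := \int[leb2 R]_(z in triangle q) (s1 z ^+ 2 + s2 z ^+ 2).
set T := \int[leb2 R]_(z in triangle q) u z.
rewrite -/T in mainT.
have s1c : integrable_on q (fun=> 1) by exact/bmeas_integrable/bmeas_cst.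
set V := \int[leb2 R]_(z in triangle q) (fun=> 1 : R) z.
apply/ler_addgt0Pr => e e0.
have SV0 : 0 < S + V + 1.
  rewrite ltr_wpDl// addr_ge0// Rintegral_ge0// => z _.
  by rewrite addr_ge0 ?sqr_ge0.
(* An approximant at distance del costs at most del (S + V + 1), where V is the
   area of the triangle. *)
pose del := e / (S + V + 1).
have del0 : 0 < del by rewrite divr_gt0.
have [phi [sphi phi0 phie]] := approx del del0.
have [np np1 np2] := smooth_bmeas q phi q0 sphi.
have lp := bmeas_square_integrable _ _ q0 np.
have lp1 := bmeas_square_integrable _ _ q0 np1.
have lp2 := bmeas_square_integrable _ _ q0 np2.
pose E z := (phi z - u z) ^+ 2 + (partial1 phi z - g1 z) ^+ 2
  + (partial2 phi z - g2 z) ^+ 2.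
have sE : integrable_on q E.
  apply: integrable_on_add; first apply: integrable_on_add.
  - by case: (l2_sub _ _ _ lp lu).
  - by case: (l2_sub _ _ _ lp1 l1).
  - by case: (l2_sub _ _ _ lp2 l2).
have IE : \int[leb2 R]_(z in triangle q) E z <= del ^+ 2.
  rewrite -lee_fin /Rintegral fineK; first exact: ltW.
  by apply: integrable_fin_num => //; exact: measurable_triangle.
have sdiv : integrable_on q (fun z => s1 z * partial1 phi z + s2 z * partial2 phi z
    - phi z).
  apply: integrable_on_add; first by apply: integrable_on_add; exact: l2_mul.
  by apply: integrable_on_opp; exact: bmeas_integrable.
have step : \int[leb2 R]_(z in triangle q)
      (2 * u z + - 1 * (g1 z * g1 z + g2 z * g2 z)) <=
    \int[leb2 R]_(z in triangle q)
      (((del * 1 + del * (s1 z ^+ 2 + s2 z ^+ 2)) + del^-1 * E z)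
       + ((s1 z ^+ 2 + s2 z ^+ 2)
       + (- 2) * (s1 z * partial1 phi z + s2 z * partial2 phi z - phi z))).
  apply: Rint_le.
  - by apply: integrable_on_add; exact: integrable_on_scale.
  - apply: integrable_on_add; apply: integrable_on_add => //; try exact: integrable_on_scale.
    by apply: integrable_on_add; exact: integrable_on_scale.
  - move=> z _; rewrite /E.
    have young (a b : R) : 2 * a * b <= del * a ^+ 2 + del^-1 * b ^+ 2.
      rewrite -subr_ge0.
      have -> : del * a ^+ 2 + del^-1 * b ^+ 2 - 2 * a * b = del * (a - b / del) ^+ 2.
        by field; rewrite gt_eqF.
      by rewrite mulr_ge0 ?sqr_ge0// ltW.
    have y1 := young 1 (u z - phi z).
    have y2 := young (s1 z) (partial1 phi z - g1 z).
    have y3 := young (s2 z) (partial2 phi z - g2 z).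
    have := sqr_ge0 (s1 z - g1 z); have := sqr_ge0 (s2 z - g2 z).
    move: y1 y2 y3; rewrite !mulrDr; move: (del^-1) => di.
    nra.
have sA := integrable_on_scale q _ del s1c; have sB := integrable_on_scale q _ del sss.
have sC := integrable_on_scale q _ del^-1 sE; have sD := integrable_on_scale q _ (-2) sdiv.
have sAB := integrable_on_add q _ _ sA sB.
rewrite (Rint_add _ _ _ (integrable_on_add q _ _ sAB sC) (integrable_on_add q _ _ sss sD)) in step.
rewrite (Rint_add _ _ _ sAB sC) (Rint_add _ _ _ sA sB) (Rint_add _ _ _ sss sD) in step.
rewrite (Rint_add _ _ _ (integrable_on_scale q _ 2 su) (integrable_on_scale q _ (-1) sgg)) in step.
rewrite (Rint_scale _ _ _ su) (Rint_scale _ _ _ sgg) in step.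
rewrite (Rint_scale _ _ _ s1c) (Rint_scale _ _ _ sss) in step.
rewrite (Rint_scale _ _ _ sE) (Rint_scale _ _ _ sdiv) (divs _ sphi phi0) mainT in step.
rewrite -/T -/S -/V in step.
have IE' : del^-1 * \int[leb2 R]_(z in triangle q) E z <= del.
  rewrite -(@ler_pM2l _ del)// mulrA divff ?gt_eqF// mul1r -expr2; exact: IE.
have dele : del * (S + V + 1) = e by rewrite /del divfK// gt_eqF.
move: step IE'; rewrite -dele; move: (del^-1 * _) => IEd.
lra.
Qed.

Lemma flux_free_add q s1 s2 d s s1' s2' d' s' : 0 < q ->
  flux_free q s1 s2 d s -> flux_free q s1' s2' d' s' ->
  flux_free q (fun z => s1 z + s1' z) (fun z => s2 z + s2' z)
    (fun z => d z + d' z) (fun y : R => s y + s' y).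
Proof.
move=> q0 [n1 n2 nd cs F] [n1' n2' nd' cs' F']; split.
- exact: bmeas_add.
- exact: bmeas_add.
- exact: bmeas_add.
- by move=> y; apply: cvgD; [exact: cs|exact: cs'].
move=> phi sphi; have [np np1 np2] := smooth_bmeas q phi q0 sphi.
transitivity (\int[leb2 R]_(z in triangle q)
  ((s1 z * partial1 phi z + s2 z * partial2 phi z + d z * phi z)
  + (s1' z * partial1 phi z + s2' z * partial2 phi z + d' z * phi z))).
  by apply: eq_Rintegral => z _; ring.
have cphi y : {for y, continuous (fun t => phi (0, t))}.
  exact: der_continuous (smooth_der2 phi 0 y sphi).
rewrite Rint_add; first last.
- by apply: bmeas_integrable => //; apply: bmeas_add; [apply: bmeas_add|]; exact: bmeas_mul.
- by apply: bmeas_integrable => //; apply: bmeas_add; [apply: bmeas_add|]; exact: bmeas_mul.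
rewrite F// F'// -opprD -RintegralD//.
- by congr (- _); apply: eq_Rintegral => y _; ring.
- apply: continuous_integrable_oo => t _; apply: cvgM; [exact: cphi|exact: cs].
- apply: continuous_integrable_oo => t _; apply: cvgM; [exact: cphi|exact: cs'].
Qed.

Lemma flux_free_scale q s1 s2 d s (c : R) : 0 < q ->
  flux_free q s1 s2 d s ->
  flux_free q (fun z => c * s1 z) (fun z => c * s2 z)
    (fun z => c * d z) (fun y : R => c * s y).
Proof.
move=> q0 [n1 n2 nd cs F]; have nc := bmeas_cst q c; split.
- exact: bmeas_mul.
- exact: bmeas_mul.
- exact: bmeas_mul.
- by move=> y; apply: cvgM; [exact: cvg_cst|exact: cs].
move=> phi sphi; have [np np1 np2] := smooth_bmeas q phi q0 sphi.
transitivity (\int[leb2 R]_(z in triangle q)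
  (c * (s1 z * partial1 phi z + s2 z * partial2 phi z + d z * phi z))).
  by apply: eq_Rintegral => z _; ring.
rewrite Rint_scale; last first.
  by apply: bmeas_integrable => //; apply: bmeas_add; [apply: bmeas_add|]; exact: bmeas_mul.
rewrite F// mulrN -RintegralZl//.
  by congr (- _); apply: eq_Rintegral => y _; ring.
apply: continuous_integrable_oo => t _; apply: cvgM; last exact: cs.
exact: der_continuous (smooth_der2 phi 0 t sphi).
Qed.

Lemma flux_free_zero q : 0 < q ->
  flux_free q (fun=> 0) (fun=> 0) (fun=> 0) (fun=> 0 : R).
Proof.
move=> q0; split; try exact: bmeas_cst; first by move=> y; exact: cvg_cst.
move=> phi sphi.
under eq_Rintegral do rewrite !mul0r !addr0.
under [in RHS]eq_Rintegral do rewrite mulr0.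
by rewrite !Rintegral_cst// ?mul0r ?oppr0//; exact: measurable_triangle.
Qed.

Lemma flux_free_sum q n (s1 s2 d : 'I_n -> R * R -> R) (s : 'I_n -> R -> R) :
  0 < q -> (forall i, flux_free q (s1 i) (s2 i) (d i) (s i)) ->
  flux_free q (fun z => \sum_(i < n) s1 i z) (fun z => \sum_(i < n) s2 i z)
    (fun z => \sum_(i < n) d i z) (fun y => \sum_(i < n) s i y).
Proof.
move=> q0; elim: n s1 s2 d s => [|n IHn] s1 s2 d s H.
  have E (T : Type) (h : 'I_0 -> T -> R) : (fun z => \sum_(i < 0) h i z) = fun=> 0.
    by apply/funext => z; rewrite big_ord0.
  by rewrite !E; exact: flux_free_zero.
have E (T : Type) (h : 'I_n.+1 -> T -> R) : (fun z => \sum_(i < n.+1) h i z) =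
    fun z => \sum_(i < n) h (widen_ord (leqnSn n) i) z + h ord_max z.
  by apply/funext => z; rewrite big_ord_recr.
by rewrite !E; apply: flux_free_add => //; apply: IHn.
Qed.

End Variational.

Ltac solve_bmeas := repeat first [ assumption | apply: bmeas_cst |
  apply: bmeas_add | apply: bmeas_mul | apply: bmeas_exprn | apply: bmeas_opp |
  apply: bmeas_sum => ? ].
Ltac generalize_integrals := repeat match goal with
  |- context [@Rintegral ?d ?T ?R ?m ?D ?f] => move: (@Rintegral d T R m D f)
  end.
Ltac solve_integrable := apply: bmeas_integrable => //; solve_bmeas.

(** * The radial function and the reduction to the side AC *)

Section Radial.
Context {R : realType}.
Notation mu := (@lebesgue_measure R).
Implicit Types (q x y : R) (f g phi : R * R -> R).

Lemma Rintegral_oo_eq0 (f : R -> R) : (forall y, 0 < y < 1 -> f y = 0) ->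
  \int[mu]_(y in `]0, 1[) f y = 0.
Proof.
move=> f0; transitivity (\int[mu]_(y in `]0, 1[) (0 : R)).
  by apply: eq_Rintegral => y; rewrite inE /= in_itv /=; exact: f0.
by rewrite Rintegral_cst// mul0r.
Qed.

(** Minus a quarter of the squared distance to B, normalized to vanish at the
origin. *)
Definition radial q (z : R * R) : R :=
  2^-1 * q * z.1 + - 4^-1 * (z.1 * z.1) + - 4^-1 * (z.2 * z.2).

Lemma smooth_radial q : smooth (radial q).
Proof.
have [s1 s2] := (@smooth_fst R, @smooth_snd R); have sc c := @smooth_cst R c.
apply: smooth_add; first apply: smooth_add; apply: smooth_mul => //;
  exact: smooth_mul.
Qed.

Definition radial1 q (z : R * R) : R := 2^-1 * (q - z.1).
Definition radial2 (z : R * R) : R := - 2^-1 * z.2.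

Lemma partial1_radial q : partial1 (radial q) = radial1 q.
Proof. by apply: partial1_eq => x y; rewrite /radial /radial1 /=; der_eq; field. Qed.

Lemma partial2_radial q : partial2 (radial q) = radial2.
Proof. by apply: partial2_eq => x y; rewrite /radial /radial2 /=; der_eq; field. Qed.

Lemma smooth_radial1 q : smooth (radial1 q).
Proof. by rewrite -partial1_radial; exact/smooth_partial1/smooth_radial. Qed.

Lemma smooth_radial2 : smooth radial2.
Proof. by rewrite -(partial2_radial 0); exact/smooth_partial2/smooth_radial. Qed.

Lemma flux_free_radial q : 0 < q ->
  flux_free q (radial1 q) radial2 (fun=> - 2^-1 + - 2^-1) (fun y => radial1 q (0, y)).
Proof.
move=> q0.
have d1 x y : is_derive x 1 (fun t => radial1 q (t, y)) (- 2^-1).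
  by rewrite /radial1 /=; der_eq; field.
have d2 x y : is_derive y 1 (fun t => radial2 (x, t)) (- 2^-1).
  by rewrite /radial2 /=; der_eq; field.
have dG (x : R) : is_derive x 1 (fun x => - 2^-1 * (1 - x / q)) (2^-1 / q).
  by der_eq; ring.
apply: (flux_freeI q (radial1 q) radial2 (fun=> - 2^-1) (fun=> - 2^-1)
  (fun x => - 2^-1 * (1 - x / q))) => //.
- by apply: bmeas_continuous => //; exact/smooth_continuous/smooth_radial1.
- by apply: bmeas_continuous => //; exact/smooth_continuous/smooth_radial2.
- exact: bmeas_cst.
- exact: bmeas_cst.
- by move=> x; exact: der_continuous (dG x).
- by move=> y; rewrite /radial1 /=; exact: cvg_cst.
- by move=> x y _ _; exact: cvg_cst.
- by move=> x y _ _; exact: cvg_cst.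
- by move=> x _; rewrite /radial2 /= mulr0.
- by move=> x _; rewrite /radial1 /=; field; rewrite gt_eqF.
Qed.

Lemma radial_energy q : 0 < q ->
  \int[leb2 R]_(z in triangle q) (radial1 q z ^+ 2 + radial2 z ^+ 2)
    = q ^+ 3 / 16 + q / 48.
Proof.
move=> q0.
have nr1 : bmeas q (radial1 q).
  by apply: bmeas_continuous => //; exact/smooth_continuous/smooth_radial1.
have nr2 : bmeas q radial2.
  by apply: bmeas_continuous => //; exact/smooth_continuous/smooth_radial2.
pose g x := (4^-1 * q ^+ 2 + 12^-1) * (1 - x / q) ^+ 3.
have inner x : 0 < x < q -> (\int[mu]_(y in `]0%R, (1 - x / q)%R[)
    (radial1 q (x, y) ^+ 2 + radial2 (x, y) ^+ 2)%:E)%E = (g x)%:E.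
  move=> /andP[x0 xq]; apply: etrans; first apply: (integral_antiderivative
    (fun y => 4^-1 * ((q - x) ^+ 2 * y + 3^-1 * y ^+ 3))
    (fun y => radial1 q (x, y) ^+ 2 + radial2 (x, y) ^+ 2)).
  - by rewrite subr_gt0 ltr_pdivrMr// mul1r.
  - by move=> y _; rewrite /radial1 /radial2 /=; der_eq; field.
  - move=> y _; have dr : is_derive y 1
        (fun t => radial1 q (x, t) ^+ 2 + radial2 (x, t) ^+ 2) (2^-1 * y).
      by rewrite /radial1 /radial2 /=; der_eq; field.
    exact: der_continuous dr.
  - by congr EFin; rewrite /g; field; rewrite gt_eqF.
have [_ ->] := fubini1_eq q (fun z => radial1 q z ^+ 2 + radial2 z ^+ 2) g q0
  (bmeas_add _ _ _ (bmeas_exprn _ _ 2 nr1) (bmeas_exprn _ _ 2 nr2)) inner.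
have derG x : is_derive x 1
    (fun x => - (16^-1 * q ^+ 3 + 48^-1 * q) * (1 - x / q) ^+ 4) (g x).
  by rewrite /g; der_eq; field; rewrite gt_eqF.
rewrite /Rintegral (integral_antiderivative _ _ _ _ q0 (fun x _ => derG x)) /=.
  by field; rewrite gt_eqF.
move=> x _; have dg : is_derive x 1 g
    (- (4^-1 * q ^+ 2 + 12^-1) * 3 * (1 - x / q) ^+ 2 / q).
  by rewrite /g; der_eq; ring.
exact: der_continuous dg.
Qed.

(** Admissible function w + phi in Dirichlet's principle; the mixed term
disappears because grad w has divergence -1 and no flux through AB and BC. *)
Lemma torsion_lower q u phi : 0 < q -> weak_solution (triangle q) sideAC u ->
  smooth phi -> (forall y, 0 <= y <= 1 -> phi (0, y) = 4^-1 * (y * y)) ->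
  q ^+ 3 / 16 + q / 48
  - \int[leb2 R]_(z in triangle q) (partial1 phi z ^+ 2 + partial2 phi z ^+ 2)
  <= \int[leb2 R]_(z in triangle q) u z.
Proof.
move=> q0 hu sp phi0; pose v z := radial q z + phi z.
have sv : smooth v by apply: smooth_add => //; exact: smooth_radial.
have v1 : partial1 v = fun z => radial1 q z + partial1 phi z.
  apply: partial1_eq => x y; rewrite -partial1_radial /v.
  by cbv beta; apply: deriv_add; apply: smooth_der1 => //; exact: smooth_radial.
have v2 : partial2 v = fun z => radial2 z + partial2 phi z.
  apply: partial2_eq => x y; rewrite -(partial2_radial q) /v.
  by cbv beta; apply: deriv_add; apply: smooth_der2 => //; exact: smooth_radial.
have v0 z : sideAC z -> v z = 0.
  case: z => x y [/= -> y01]; rewrite /v /radial phi0//=; ring.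
apply: le_trans (torsion_ge q u v q0 hu sv v0).
have [nr1 nr2] : bmeas q (radial1 q) /\ bmeas q radial2.
  by have [? ?] := flux_free_radial q q0.
have [nv nv1 nv2] := smooth_bmeas q v q0 sv.
have [np np1 np2] := smooth_bmeas q phi q0 sp.
have [_ _ _ _ /(_ v sv)] := flux_free_radial q q0.
rewrite Rintegral_oo_eq0 => [|y /andP[y0 y1]]; last first.
  by rewrite v0 ?mul0r//; split => //=; rewrite !ltW.
rewrite oppr0.
set dv := \int[_]_(z in _) _ => divv.
have E : \int[leb2 R]_(z in triangle q) (radial1 q z ^+ 2 + radial2 z ^+ 2)
    + \int[leb2 R]_(z in triangle q) (partial1 v z ^+ 2 + partial2 v z ^+ 2)
  = \int[leb2 R]_(z in triangle q) (partial1 phi z ^+ 2 + partial2 phi z ^+ 2)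
    + (2 * \int[leb2 R]_(z in triangle q) v z + 2 * dv).
  rewrite /dv -!Rint_scale; try by solve_integrable.
  rewrite -!Rint_add; try by solve_integrable.
  by apply: eq_Rintegral => z _; rewrite v1 v2 /v; field.
rewrite -(radial_energy _ q0); move: E; rewrite divv; clear; generalize_integrals => *; lra.
Qed.

(** Admissible field grad w + r in Thomson's principle; the mixed term is the
integral of r . grad w, which Green's formula moves to AC, where w = -y^2/4. *)
Lemma torsion_upper q u (r1 r2 d : R * R -> R) (s : R -> R) :
  0 < q -> weak_solution (triangle q) sideAC u ->
  flux_free q r1 r2 d s -> (forall z, d z = 0) ->
  \int[leb2 R]_(z in triangle q) u z <=
  q ^+ 3 / 16 + q / 48 + 2 * \int[mu]_(y in `]0, 1[) (4^-1 * (y * y) * s y)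
  + \int[leb2 R]_(z in triangle q) (r1 z ^+ 2 + r2 z ^+ 2).
Proof.
move=> q0 hu Fr d0; have Fw := flux_free_radial q q0.
have [nw1 nw2 _ _ _] := Fw; have [nr1 nr2 _ cs FFr] := Fr.
have [n1 n2 nd cS FF] := flux_free_add _ _ _ _ _ _ _ _ _ q0 Fw Fr.
apply: le_trans (torsion_le q u _ _ q0 hu n1 n2 _) _.
  move=> v sv v0; have [nv nv1 nv2] := smooth_bmeas q v q0 sv.
  have := FF v sv.
  rewrite Rintegral_oo_eq0 => [|y /andP[y0 y1]]; last first.
    by rewrite v0 ?mul0r//; split => //=; rewrite !ltW.
  rewrite oppr0 => <-.
  by apply: eq_Rintegral => z _; rewrite d0; field.
have -> : 2 * \int[mu]_(y in `]0, 1[) (4^-1 * (y * y) * s y) =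
    2 * \int[leb2 R]_(z in triangle q) (r1 z * radial1 q z + r2 z * radial2 z).
  congr (2 * _); have := FFr _ (smooth_radial q).
  rewrite partial1_radial partial2_radial => FFw.
  transitivity (- \int[mu]_(y in `]0, 1[) (radial q (0, y) * s y)).
    rewrite -[RHS]mulN1r -RintegralZl//.
      by apply: eq_Rintegral => y _; rewrite /radial /=; ring.
    apply: continuous_integrable_oo => t _; apply: cvgM; last exact: cs.
    exact: der_continuous (smooth_der2 _ 0 t (smooth_radial q)).
  rewrite -FFw; apply: eq_Rintegral => z _; rewrite d0; ring.
rewrite -radial_energy// -Rint_scale; last by solve_integrable.
rewrite -!Rint_add; try by solve_integrable.
apply: Rint_le; [solve_integrable|solve_integrable|move=> z _].
by rewrite le_eqVlt; apply/orP; left; apply/eqP; ring.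
Qed.

End Radial.

(** * Orthogonality of sines and cosines *)

Section Trig.
Context {R : realType}.
Implicit Types (q x y : R) (c w : nat -> R).

(** Antiderivatives of the products of two cosines, and below of two sines,
of frequencies w j and w k. They vanish, for j <> k, wherever all the sines do,
which is how orthogonality appears. *)
Definition cos_cos w (j k : nat) y : R :=
  if j == k then 2^-1 * y + (2 * w j)^-1 * (sin (w j * y) * cos (w j * y))
  else (w j ^+ 2 - w k ^+ 2)^-1 *
    (w j * (sin (w j * y) * cos (w k * y)) - w k * (cos (w j * y) * sin (w k * y))).

Definition sin_sin w (j k : nat) y : R :=
  if j == k then 2^-1 * y - (2 * w j)^-1 * (sin (w j * y) * cos (w j * y))
  else (w j ^+ 2 - w k ^+ 2)^-1 *
    (w k * (sin (w j * y) * cos (w k * y)) - w j * (cos (w j * y) * sin (w k * y))).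

Lemma sqr_freq_neq w j k : (forall i, 0 < w i) -> injective w -> j != k ->
  w j ^+ 2 - w k ^+ 2 != 0.
Proof.
move=> w0 wi jk; rewrite subr_eq0 eqrXn2 ?ltW//.
by apply: contra jk => /eqP /wi ->; exact: eqxx.
Qed.

Lemma der_cos_cos w j k y : (forall i, 0 < w i) -> injective w ->
  is_derive y 1 (cos_cos w j k) (cos (w j * y) * cos (w k * y)).
Proof.
move=> w0 wi; rewrite /cos_cos; have wj : w j != 0 by rewrite gt_eqF.
have [<-|jk] := eqVneq j k; der_eq.
  have := cos2Dsin2 (w j * y); move: (sin _) (cos _) => s c E.
  transitivity (2^-1 * (c ^+ 2 + s ^+ 2) + 2^-1 * (c ^+ 2 - s ^+ 2)); last by field.
  by rewrite E; field.
have := sqr_freq_neq _ _ _ w0 wi jk.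
move: (sin (w j * y)) (cos (w j * y)) (sin (w k * y)) (cos (w k * y)) => a b e d nz.
by field.
Qed.

Lemma der_sin_sin w j k y : (forall i, 0 < w i) -> injective w ->
  is_derive y 1 (sin_sin w j k) (sin (w j * y) * sin (w k * y)).
Proof.
move=> w0 wi; rewrite /sin_sin; have wj : w j != 0 by rewrite gt_eqF.
have [<-|jk] := eqVneq j k; der_eq.
  have := cos2Dsin2 (w j * y); move: (sin _) (cos _) => s c E.
  transitivity (2^-1 * (c ^+ 2 + s ^+ 2) - 2^-1 * (c ^+ 2 - s ^+ 2)); last by field.
  by rewrite E; field.
have := sqr_freq_neq _ _ _ w0 wi jk.
move: (sin (w j * y)) (cos (w j * y)) (sin (w k * y)) (cos (w k * y)) => a b e d nz.
by field.
Qed.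

(** Antiderivative of the square of a cosine sum; expanding the square before
integrating makes Parseval's identity an evaluation at the endpoints. *)
Definition cos_energy n c w y := \sum_(j < n) \sum_(k < n) c j * c k * cos_cos w j k y.
Definition sin_energy n c w y := \sum_(j < n) \sum_(k < n) c j * c k * sin_sin w j k y.

Lemma der_cos_energy n c w y : (forall i, 0 < w i) -> injective w ->
  is_derive y 1 (cos_energy n c w) ((\sum_(j < n) c j * cos (w j * y)) ^+ 2).
Proof.
move=> w0 wi; rewrite /cos_energy; eapply is_derive_eq.
  apply: deriv_sum => j; apply: deriv_sum => k.
  exact: deriv_cmul (der_cos_cos w j k y w0 wi).
rewrite expr2 big_distrlr /=; apply: eq_bigr => j _; apply: eq_bigr => k _.
by rewrite mulrACA.
Qed.

Lemma der_sin_energy n c w y : (forall i, 0 < w i) -> injective w ->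
  is_derive y 1 (sin_energy n c w) ((\sum_(j < n) c j * sin (w j * y)) ^+ 2).
Proof.
move=> w0 wi; rewrite /sin_energy; eapply is_derive_eq.
  apply: deriv_sum => j; apply: deriv_sum => k.
  exact: deriv_cmul (der_sin_sin w j k y w0 wi).
rewrite expr2 big_distrlr /=; apply: eq_bigr => j _; apply: eq_bigr => k _.
by rewrite mulrACA.
Qed.

Lemma cos_energyE n c w y : (forall i, sin (w i * y) = 0) ->
  cos_energy n c w y = 2^-1 * y * \sum_(j < n) c j ^+ 2.
Proof.
move=> s0; rewrite mulr_sumr; apply: eq_bigr => j _.
rewrite (bigD1 j)//= big1 => [|k kj]; rewrite /cos_cos.
  by rewrite eqxx s0; ring.
have -> : (j == k :> nat) = false by rewrite eq_sym; exact: (negPf kj).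
by rewrite !s0; ring.
Qed.

Lemma sin_energyE n c w y : (forall i, sin (w i * y) = 0) ->
  sin_energy n c w y = 2^-1 * y * \sum_(j < n) c j ^+ 2.
Proof.
move=> s0; rewrite mulr_sumr; apply: eq_bigr => j _.
rewrite (bigD1 j)//= big1 => [|k kj]; rewrite /sin_sin.
  by rewrite eqxx s0; ring.
have -> : (j == k :> nat) = false by rewrite eq_sym; exact: (negPf kj).
by rewrite !s0; ring.
Qed.

Definition freq (i : nat) : R := i.+1%:R * pi.

Lemma freq_gt0 i : 0 < freq i.
Proof. by rewrite mulr_gt0// pi_gt0. Qed.

Lemma freq_inj : injective freq.
Proof.
move=> i j /mulIf; rewrite gt_eqF ?pi_gt0// => /(_ isT) /eqP.
by rewrite eqr_nat eqSS => /eqP.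
Qed.

Lemma sin_cos_freq i : sin (freq i) = 0 /\ cos (freq i) = (-1) ^+ i.+1.
Proof.
rewrite /freq; elim: i => [|i [IHs IHc]]; first by rewrite mul1r sinpi cospi.
rewrite -[i.+2]addn1 natrD mulrDl mul1r sinDpi cosDpi IHs IHc oppr0; split => //.
by rewrite addn1 [in RHS]exprS mulN1r.
Qed.

Lemma sin_freq i : sin (freq i) = 0. Proof. by case: (sin_cos_freq i). Qed.
Lemma cos_freq i : cos (freq i) = (-1) ^+ i.+1.
Proof. by case: (sin_cos_freq i). Qed.

End Trig.

(** * Divergence-free fields adapted to the triangle *)

Section Stream.
Context {R : realType}.
Notation RR := (measurableTypeR R).
Implicit Types (q k x y : R) (f g phi : R * R -> R).

Lemma bmeas_height q : 0 < q -> bmeas q (fun z => 1 - z.1 / q).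
Proof.
move=> q0; apply: bmeas_continuous => // z.
apply: cvgB; first exact: cvg_cst.
by apply: cvgM; [exact: cvg_fst|exact: cvg_cst].
Qed.

(** On the triangle this quotient lies between 0 and 1, although its
denominator tends to 0 at B. *)
Lemma bmeas_slope q : 0 < q -> bmeas q (fun z => z.2 / (1 - z.1 / q)).
Proof.
move=> q0; split.
  have m2 : measurable_fun (triangle q : set (RR * RR)) (fun z => z.2).
    by apply: measurable_funTS; exact: measurable_snd.
  apply: measurable_funM => //.
  apply: (@eq_measurable_fun _ _ _ _ _ (fun z : RR * RR => (1 - z.1 / q) `^ (- 1))).
    move=> z; rewrite inE => -[_ _ z2 zl].
    by rewrite powR_inv1// ltW//; exact: lt_trans zl.
  apply: (measurableT_comp (measurable_powR _)).
  by case: (bmeas_height q q0).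
exists 1 => z [_ _ z2 zl]; have l0 := lt_trans z2 zl.
by rewrite ger0_norm ?divr_ge0 ?ltW// ltr_pdivrMr// mul1r.
Qed.

Lemma bmeas_cos q f : bmeas q f -> bmeas q (fun z => cos (f z)).
Proof.
move=> [mf _]; split; last by exists 1 => z _; exact: cos_max.
apply: (measurableT_comp _ mf); apply: continuous_measurable_fun.
exact: continuous_cos.
Qed.

Lemma bmeas_sin q f : bmeas q f -> bmeas q (fun z => sin (f z)).
Proof.
move=> [mf _]; split; last by exists 1 => z _; exact: sin_max.
apply: (measurableT_comp _ mf); apply: continuous_measurable_fun.
exact: continuous_sin.
Qed.

Lemma bmeas_expR1 q k : 0 < q -> bmeas q (fun z => expR (k * z.1)).
Proof.
by move=> q0; apply: bmeas_continuous => //; exact/smooth_continuous/smooth_expR1.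
Qed.

Lemma bmeas_snd q : 0 < q -> bmeas q (fun z => z.2).
Proof.
by move=> q0; apply: bmeas_continuous => // z; exact: cvg_snd.
Qed.

(** [rot1] and [rot2] are the y-derivative, and minus the x-derivative, of the
stream function L^2 sin(k y / L) exp(-k x). The sine makes it vanish on AB and
BC. The square of L makes the second derivatives of the stream function bounded
near B. *)
Definition rot1 q k (z : R * R) : R :=
  k * (1 - z.1 / q) * cos (k * (z.2 / (1 - z.1 / q))) * expR (- k * z.1).

Definition rot2 q k (z : R * R) : R :=
  (2 / q * (1 - z.1 / q) * sin (k * (z.2 / (1 - z.1 / q)))
   - k / q * z.2 * cos (k * (z.2 / (1 - z.1 / q)))
   + k * (1 - z.1 / q) ^+ 2 * sin (k * (z.2 / (1 - z.1 / q))))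
  * expR (- k * z.1).

(** The y-derivative of [rot2], which is minus the x-derivative of [rot1] as
the field is divergence-free. *)
Definition rot12 q k (z : R * R) : R :=
  k * (q^-1 * cos (k * (z.2 / (1 - z.1 / q)))
       + k / q * (z.2 / (1 - z.1 / q)) * sin (k * (z.2 / (1 - z.1 / q)))
       + k * (1 - z.1 / q) * cos (k * (z.2 / (1 - z.1 / q))))
  * expR (- k * z.1).

Lemma bmeas_rot q k : 0 < q ->
  [/\ bmeas q (rot1 q k), bmeas q (rot2 q k) & bmeas q (rot12 q k)].
Proof.
move=> q0; have nh := bmeas_height q q0; have ns := bmeas_slope q q0.
have n2 := bmeas_snd q q0; have ne := bmeas_expR1 q (- k) q0.
have nks : bmeas q (fun z => k * (z.2 / (1 - z.1 / q))).
  by apply: bmeas_mul => //; exact: bmeas_cst.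
have nc := bmeas_cos _ _ nks; have nsn := bmeas_sin _ _ nks.
by split; solve_bmeas.
Qed.

Lemma der_rot1 q k x y : 0 < q -> 0 < 1 - x / q ->
  is_derive x 1 (fun t => rot1 q k (t, y)) (- rot12 q k (x, y)).
Proof.
move=> q0 l0; have ql : q != 0 by rewrite gt_eqF.
have ll : 1 - x / q != 0 by rewrite gt_eqF.
have qx : q - x != 0.
  by apply: contra ll; rewrite subr_eq0 => /eqP <-; rewrite divff// subrr.
rewrite /rot1 /rot12 /=; der_eq.
move: (cos _) (sin _) (expR _) => c s e.
by field; rewrite ql qx.
Qed.

Lemma der_rot2 q k x y : 0 < q -> 0 < 1 - x / q ->
  is_derive y 1 (fun t => rot2 q k (x, t)) (rot12 q k (x, y)).
Proof.
move=> q0 l0; have ql : q != 0 by rewrite gt_eqF.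
have ll : 1 - x / q != 0 by rewrite gt_eqF.
have qx : q - x != 0.
  by apply: contra ll; rewrite subr_eq0 => /eqP <-; rewrite divff// subrr.
rewrite /rot2 /rot12 /=; der_eq.
move: (cos _) (sin _) (expR _) => c s e.
by field; rewrite ql qx.
Qed.

Lemma flux_free_rot q i : 0 < q -> let k := freq i in
  flux_free q (rot1 q k) (rot2 q k) (fun z => - rot12 q k z + rot12 q k z)
    (fun y => rot1 q k (0, y)).
Proof.
move=> q0 k; have [n1 n2 n12] := bmeas_rot q k q0.
have h1 x y : 0 < y < 1 -> 0 <= x <= q * (1 - y) -> 0 < 1 - x / q.
  move=> /andP[y0 y1] /andP[x0 xl]; rewrite subr_gt0 ltr_pdivrMr// mul1r.
  by apply: le_lt_trans xl _; rewrite gtr_pMr// gtrBl.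
have h2 x y : 0 < x < q -> 0 <= y <= 1 - x / q -> 0 < 1 - x / q.
  by move=> /andP[x0 xq] _; rewrite subr_gt0 ltr_pdivrMr// mul1r.
have qn : q != 0 by rewrite gt_eqF.
have hn x : 0 < 1 - x / q -> 1 - x / q != 0 by move=> l0; rewrite gt_eqF.
pose G (x : R) := - (k / q * (1 - x / q)) * (- 1) ^+ i.+1 * expR (- k * x).
have cG : continuous G by move=> x; rewrite /G; eapply der_continuous; der.
have c1 : continuous (fun y => rot1 q k (0, y)).
  move=> y; have l0 : 1 - 0 / q != 0 by rewrite mul0r subr0 oner_eq0.
  by rewrite /rot1 /=; eapply der_continuous; der.
have c12 x y : 0 < 1 - x / q -> {for x, continuous (fun t => rot12 q k (t, y))}.
  by move=> /hn l0; rewrite /rot12 /=; eapply der_continuous; der.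
have c12' x y : 0 < 1 - x / q -> {for y, continuous (fun t => rot12 q k (x, t))}.
  by move=> /hn l0; rewrite /rot12 /=; eapply der_continuous; der.
have b0 x : 0 < x < q -> rot2 q k (x, 0) = 0.
  by move=> _; rewrite /rot2 /= mul0r !mulr0 sin0; ring.
have b1 x : 0 < x < q -> rot2 q k (x, 1 - x / q) = G x.
  move=> /andP[x0 xq]; have l0 : 1 - x / q != 0.
    by apply: hn; rewrite subr_gt0 ltr_pdivrMr// mul1r.
  by rewrite /rot2 /G /= divff// mulr1 sin_freq cos_freq; ring.
have b2 x : 0 < x < q -> rot1 q k (x, 1 - x / q) = - q * G x.
  move=> /andP[x0 xq]; have l0 : 1 - x / q != 0.
    by apply: hn; rewrite subr_gt0 ltr_pdivrMr// mul1r.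
  by rewrite /rot1 /G /= divff// mulr1 cos_freq; field.
exact: (flux_freeI q _ _ _ _ G q0 n1 n2 (bmeas_opp _ _ n12) n12 cG c1
  (fun x y hy hx => der_rot1 q k x y q0 (h1 x y hy hx))
  (fun x y hy hx => continuousN (c12 x y (h1 x y hy hx)))
  (fun x y hy hx => der_rot2 q k x y q0 (h2 x y hy hx))
  (fun x y hy hx => c12' x y (h2 x y hy hx)) b0 b1 b2).
Qed.

End Stream.

(** * Upper bound *)

Section Upper.
Context {R : realType}.
Notation mu := (@lebesgue_measure R).
Notation freq := (@freq R).
Implicit Types (q k x y : R) (f g phi : R * R -> R).

Lemma freq_ge1 i : 1 <= freq i.
Proof.
have pi1 : 1 <= pi :> R by apply: le_trans (@pi_ge2 R); rewrite ler1n.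
by apply: le_trans pi1 _; rewrite /freq ler_peMl ?pi_ge0// ler1n.
Qed.

(** Dirichlet energy in the half-strip of the first n modes. *)
Definition strip_energy n : R := \sum_(i < n) (2 * freq i ^+ 3)^-1.

(** Minus the cosine coefficients of y^2/4 on [0, 1]. *)
Definition mode_coef (i : nat) : R := (-1) ^+ i / freq i ^+ 2.

Lemma mode_coef_sqr i : mode_coef i ^+ 2 * freq i / 2 = (2 * freq i ^+ 3)^-1.
Proof.
have f0 : freq i != 0 by rewrite gt_eqF// freq_gt0.
by rewrite /mode_coef expr_div_n sqrr_sign; field.
Qed.

(** Sum of the rotated modes; on AC its first component is the derivative of
minus the sine series conjugate to the cosine series of y^2/4. *)
Definition rho1 q n (z : R * R) := \sum_(i < n) mode_coef i * rot1 q (freq i) z.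
Definition rho2 q n (z : R * R) := \sum_(i < n) mode_coef i * rot2 q (freq i) z.

(** Up to powers of L, the three sums into which [rho1] and [rho2] split. The
first two are, up to sign, the components of the gradient in the half-strip,
read in the variable y / L; the third only occurs with a factor 1 / q. *)
Definition cos_part q n (z : R * R) : R := \sum_(i < n)
  (mode_coef i * freq i * expR (- freq i * z.1)) * cos (freq i / (1 - z.1 / q) * z.2).
Definition sin_part q n (z : R * R) : R := \sum_(i < n)
  (mode_coef i * freq i * expR (- freq i * z.1)) * sin (freq i / (1 - z.1 / q) * z.2).
Definition sin_part0 q n (z : R * R) : R := \sum_(i < n)
  (mode_coef i * expR (- freq i * z.1)) * sin (freq i / (1 - z.1 / q) * z.2).

Let slopeE (a b c : R) : a / b * c = a * (c / b).
Proof. by rewrite mulrAC mulrA. Qed.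

Lemma rho1E q n z : rho1 q n z = (1 - z.1 / q) * cos_part q n z.
Proof.
rewrite mulr_sumr; apply: eq_bigr => i _; rewrite /rot1.
by rewrite !(slopeE (freq i)); ring.
Qed.

Lemma rho2E q n z : rho2 q n z = 2 / q * (1 - z.1 / q) * sin_part0 q n z
  - z.2 / q * cos_part q n z + (1 - z.1 / q) ^+ 2 * sin_part q n z.
Proof.
rewrite !mulr_sumr -sumrB -big_split /=; apply: eq_bigr => i _; rewrite /rot2.
by rewrite !(slopeE (freq i)); ring.
Qed.

Lemma bmeas_parts q n : 0 < q ->
  [/\ bmeas q (cos_part q n), bmeas q (sin_part q n) & bmeas q (sin_part0 q n)].
Proof.
move=> q0; have nks i : bmeas q (fun z => freq i / (1 - z.1 / q) * z.2).
  have := bmeas_mul _ _ _ (bmeas_cst q (freq i)) (bmeas_slope q q0).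
  by under eq_fun do rewrite -slopeE.
have nc i := bmeas_cos _ _ (nks i); have nsn i := bmeas_sin _ _ (nks i).
have ne i := bmeas_expR1 q (- freq i) q0.
split; apply: bmeas_sum => i.
- exact: (bmeas_mul _ _ _
    (bmeas_mul _ _ _ (bmeas_cst q (mode_coef i * freq i)) (ne i)) (nc i)).
- exact: (bmeas_mul _ _ _
    (bmeas_mul _ _ _ (bmeas_cst q (mode_coef i * freq i)) (ne i)) (nsn i)).
- exact: (bmeas_mul _ _ _
    (bmeas_mul _ _ _ (bmeas_cst q (mode_coef i)) (ne i)) (nsn i)).
Qed.

(** All mixed terms carry a factor 1 / q and are split by Young's inequality;
0 < y < L <= 1 bounds the remaining factors. *)
Lemma rho_pointwise q n z : 1 <= q -> triangle q z ->
  rho1 q n z ^+ 2 + rho2 q n z ^+ 2 <=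
  (1 + 4 / q) * cos_part q n z ^+ 2 + (1 + 1 / q) * sin_part q n z ^+ 2
  + 16 / q * sin_part0 q n z ^+ 2.
Proof.
move=> q1 [z1 z1q z2 zl]; rewrite rho1E rho2E.
have q0 : 0 < q by apply: lt_le_trans q1.
have l1 : 1 - z.1 / q <= 1 by rewrite gerBl divr_ge0// ltW.
move: (1 - z.1 / q) zl l1 => L zl l1.
have L0 : 0 < L := lt_trans z2 zl.
move: (cos_part q n z) (sin_part q n z) (sin_part0 q n z) (z.2) z2 zl => A P S y y0 yl.
have qi0 : 0 < q^-1 by rewrite invr_gt0.
have qi1 : q^-1 <= 1 by rewrite invf_le1.
move: (q^-1) qi0 qi1 => d d0 d1.
clear z1 z1q z q1 q0 q n.
have L2 : L ^+ 2 <= 1 by rewrite expr_le1// ltW.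
have sq (a c : R) : 0 <= a <= 1 -> (a * c) ^+ 2 <= c ^+ 2.
  by move=> /andP[a0 a1]; rewrite exprMn ler_piMl ?sqr_ge0// expr_le1.
have L01 : 0 <= L <= 1 by rewrite l1 ltW.
have y01 : 0 <= y <= 1 by rewrite (ltW y0) (le_trans (ltW yl)).
have hA := sq L A L01; have hS := sq L S L01; have hy := sq y A y01.
have hP : (L ^+ 2 * P) ^+ 2 <= P ^+ 2 by apply: sq; rewrite L2 sqr_ge0.
pose X := 2 * (L * S) - y * A.
have hX : X ^+ 2 <= 8 * S ^+ 2 + 2 * A ^+ 2.
  rewrite /X; have := sqr_ge0 (2 * (L * S) + y * A).
  move: (L * S) (y * A) hS hy => a c ha hc h.
  have -> : (2 * a - c) ^+ 2 = 8 * a ^+ 2 + 2 * c ^+ 2 - (2 * a + c) ^+ 2 by ring.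
  lra.
have -> : 2 * d * L * S - y * d * A + L ^+ 2 * P = L ^+ 2 * P + d * X.
  by rewrite /X; ring.
move: (L ^+ 2 * P) (L * A) X hX hA hP => a c X hX hA hP.
have h1 : (a + d * X) ^+ 2 <= (1 + d) * a ^+ 2 + 2 * d * X ^+ 2.
  have := mulr_ge0 (ltW d0) (sqr_ge0 (a - X)).
  have : d * (d * X ^+ 2) <= d * X ^+ 2.
    by rewrite ler_piMl// mulr_ge0 ?sqr_ge0// ltW.
  lra.
have h2 : (1 + d) * a ^+ 2 <= (1 + d) * P ^+ 2 by rewrite ler_pM2l// addr_gt0.
have h3 : d * X ^+ 2 <= d * (8 * S ^+ 2 + 2 * A ^+ 2) by rewrite ler_pM2l.
lra.
Qed.

(** At fixed x the frequencies k / L make all sines vanish at y = 0 and y = L,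
so the modes are orthogonal on the section. *)
Lemma rho_inner q n x : 0 < q -> 0 < x < q ->
  let dC := fun i => mode_coef i * freq i * expR (- freq i * x) in
  let dS := fun i => mode_coef i * expR (- freq i * x) in
  (\int[mu]_(y in `]0%R, (1 - x / q)%R[)
    ((1 + 4 / q) * cos_part q n (x, y) ^+ 2
     + (1 + 1 / q) * sin_part q n (x, y) ^+ 2
     + 16 / q * sin_part0 q n (x, y) ^+ 2)%:E)%E
  = (2^-1 * (1 - x / q) * ((1 + 4 / q) * \sum_(i < n) dC i ^+ 2
      + (1 + 1 / q) * \sum_(i < n) dC i ^+ 2
      + 16 / q * \sum_(i < n) dS i ^+ 2))%:E.
Proof.
move=> q0 /andP[x0 xq] dC dS; set L := 1 - x / q.
have L0 : 0 < L by rewrite subr_gt0 ltr_pdivrMr// mul1r.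
pose w i := freq i / L.
have w0 i : 0 < w i by rewrite divr_gt0// freq_gt0.
have wi : injective w.
  by move=> i j /mulIf; rewrite invr_eq0 gt_eqF// => /(_ isT) /freq_inj.
have sL i : sin (w i * L) = 0 by rewrite /w divfK ?gt_eqF// sin_freq.
have s0 i : sin (w i * 0) = 0 by rewrite mulr0 sin0.
pose F y := (1 + 4 / q) * cos_energy n dC w y + (1 + 1 / q) * sin_energy n dC w y
  + 16 / q * sin_energy n dS w y.
pose f y := (1 + 4 / q) * (\sum_(i < n) dC i * cos (w i * y)) ^+ 2
  + (1 + 1 / q) * (\sum_(i < n) dC i * sin (w i * y)) ^+ 2
  + 16 / q * (\sum_(i < n) dS i * sin (w i * y)) ^+ 2.
have dF (t : R) : is_derive t 1 F (f t).
  rewrite /F; apply: deriv_add; first apply: deriv_add.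
  - exact: deriv_cmul (der_cos_energy _ _ _ _ w0 wi).
  - exact: deriv_cmul (der_sin_energy _ _ _ _ w0 wi).
  - exact: deriv_cmul (der_sin_energy _ _ _ _ w0 wi).
have cf (t : R) : {for t, continuous f} by rewrite /f; eapply der_continuous; der.
apply: etrans (integral_antiderivative F f 0 L L0 (fun t _ => dF t) (fun t _ => cf t)) _.
by rewrite /F !cos_energyE// !sin_energyE//; congr EFin; ring.
Qed.

(** Each mode contributes at most the integral over x > 0 of its square, with
the factor L <= 1 dropped; the constant does not depend on n. *)
Lemma rho_energy q n : 1 <= q ->
  \int[leb2 R]_(z in triangle q) (rho1 q n z ^+ 2 + rho2 q n z ^+ 2)
  <= (1 + 11 / q) * strip_energy n.
Proof.
move=> q1; have q0 : 0 < q by apply: lt_le_trans q1.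
have qi0 : 0 < q^-1 by rewrite invr_gt0.
have [nC nS nS0] := bmeas_parts q n q0.
have nr1 : bmeas q (rho1 q n).
  apply: bmeas_sum => i; apply: bmeas_mul; first exact: bmeas_cst.
  by case: (bmeas_rot q (freq i) q0).
have nr2 : bmeas q (rho2 q n).
  apply: bmeas_sum => i; apply: bmeas_mul; first exact: bmeas_cst.
  by case: (bmeas_rot q (freq i) q0).
pose f z := (1 + 4 / q) * cos_part q n z ^+ 2 + (1 + 1 / q) * sin_part q n z ^+ 2
  + 16 / q * sin_part0 q n z ^+ 2.
have nf : bmeas q f by rewrite /f; solve_bmeas.
apply: (@le_trans _ _ (\int[leb2 R]_(z in triangle q) f z)).
  apply: Rint_le; first by solve_integrable.
    exact: bmeas_integrable.
  by move=> z; exact: rho_pointwise.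
pose B x := (1 + 11 / q) * (\sum_(i < n)
  - (mode_coef i ^+ 2 * freq i / 2) * expR (- freq i * x) ^+ 2).
pose dB x := (1 + 11 / q) * (\sum_(i < n)
  (mode_coef i * freq i * expR (- freq i * x)) ^+ 2).
have derB x : is_derive x 1 B (dB x).
  rewrite /B /dB; apply: deriv_cmul; eapply is_derive_eq; first by der.
  by cbv beta; apply: eq_bigr => i _; field.
have cdB : continuous dB by move=> x; rewrite /dB; eapply der_continuous; der.
apply: (@le_trans _ _ (B q - B 0)).
  apply: (fubini1_le q f _ B dB q0 nf (fun x xq => rho_inner q n x q0 xq) _ derB cdB).
  move=> x /andP[x0 xq]; rewrite /dB; cbv beta zeta.
  set SC := \sum_(i < n) _; set SS := \sum_(i < n) _ ^+ 2.
  have SS0 : 0 <= SS by apply: sumr_ge0 => i _; exact: sqr_ge0.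
  have SSC : SS <= SC.
    apply: ler_sum => i _.
    rewrite (mulrC (mode_coef i) (freq i)) -(mulrA (freq i)); move: (mode_coef i * _) => a.
    rewrite exprMn ler_peMl ?sqr_ge0//.
    by rewrite exprn_ege1// freq_ge1.
  have L0 : 0 <= 1 - x / q by rewrite subr_ge0 ler_pdivrMr// mul1r ltW.
  have L1 : 1 - x / q <= 1 by rewrite gerBl divr_ge0// ltW.
  move: (1 - x / q) L0 L1 => L L0 L1; move: (q^-1) qi0 => d d0.
  have SC0 : 0 <= SC := le_trans SS0 SSC.
  move: SS SC SS0 SSC SC0 => SS SC SS0 SSC SC0.
  (* The constant 11 covers half of 4 + 1 + 16. *)
  have h : (1 + 4 * d) * SC + (1 + 1 * d) * SC + 16 * d * SS
      <= 2 * ((1 + 11 * d) * SC).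
    have : d * SS <= d * SC by rewrite ler_pM2l.
    have := mulr_ge0 (ltW d0) SC0; lra.
  have h0 : 0 <= (1 + 4 * d) * SC + (1 + 1 * d) * SC + 16 * d * SS.
    have := mulr_ge0 (ltW d0) SC0; have := mulr_ge0 (ltW d0) SS0; lra.
  move: (_ + 16 * d * SS) h h0 => T h h0.
  have : L * T <= T by rewrite ler_piMl.
  lra.
have -> : strip_energy n = \sum_(i < n) mode_coef i ^+ 2 * freq i / 2.
  by apply: eq_bigr => i _; rewrite mode_coef_sqr.
rewrite /B -mulrBr; apply: ler_wpM2l; first by rewrite addr_ge0// divr_ge0// ltW.
rewrite -sumrB; apply: ler_sum => i _; rewrite mulr0 expR0.
have r0 : 0 <= mode_coef i ^+ 2 * freq i / 2.
  by rewrite divr_ge0// mulr_ge0 ?sqr_ge0// ltW// freq_gt0.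
have := mulr_ge0 r0 (sqr_ge0 (expR (- freq i * q))); lra.
Qed.

(** The k-th cosine coefficient of y^2 is explicit, and the sum that results is
again the energy of the half-strip: for the harmonic function the energy is the
boundary pairing of its trace and its flux. *)
Lemma rho_trace q n : 0 < q ->
  \int[mu]_(y in `]0, 1[) (4^-1 * (y * y)
     * \sum_(i < n) mode_coef i * rot1 q (freq i) (0, y)) = - strip_energy n.
Proof.
move=> q0.
pose F y := \sum_(i < n) 4^-1 * (mode_coef i * freq i) * (y ^+ 2 * sin (freq i * y) / freq i
  + 2 * y * cos (freq i * y) / freq i ^+ 2 - 2 * sin (freq i * y) / freq i ^+ 3).
have f0 i : freq i != 0 by rewrite gt_eqF// freq_gt0.
pose f y := 4^-1 * (y * y) * \sum_(i < n) mode_coef i * rot1 q (freq i) (0, y).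
have dF (t : R) : is_derive t 1 F (f t).
  rewrite /F; eapply is_derive_eq; first by der.
  cbv beta; rewrite /f mulr_sumr; apply: eq_bigr => i _.
  rewrite /rot1 /= ?mul0r ?subr0 ?mulr1 ?divr1 ?mulr0 ?expR0.
  by field.
have cf (t : R) : {for t, continuous f}.
  have l0 : 1 - 0 / q != 0 by rewrite mul0r subr0 oner_eq0.
  by rewrite /f /rot1 /=; eapply der_continuous; der.
have := integral_antiderivative F f 0 1 ltr01 (fun t _ => dF t) (fun t _ => cf t).
rewrite /Rintegral => -> /=.
rewrite /F -sumrB /strip_energy -sumrN; apply: eq_bigr => i _.
rewrite !mulr1 !mulr0 sin0 cos0 sin_freq cos_freq /mode_coef ![(-1) ^+ i.+1]exprS.
have := sqrr_sign R i; move: ((-1) ^+ i) => s s2.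
transitivity (- (2 * freq i ^+ 3)^-1 * s ^+ 2); last by rewrite s2 mulr1.
by field.
Qed.

(** The mixed term contributes twice the energy with a minus sign and the
square contributes it once. *)
Lemma torsion_upper_strip q u n : 1 <= q ->
  weak_solution (triangle q) sideAC u ->
  \int[leb2 R]_(z in triangle q) u z <=
  q ^+ 3 / 16 + q / 48 - strip_energy n + 11 / q * strip_energy n.
Proof.
move=> q1 hu; have q0 : 0 < q by apply: lt_le_trans q1.
have F := flux_free_sum q n _ _ _ _ q0
  (fun i => flux_free_scale q _ _ _ _ (mode_coef i) q0 (flux_free_rot q i q0)).
have d0 z : \sum_(i < n) mode_coef i * (- rot12 q (freq i) z + rot12 q (freq i) z) = 0.
  by apply: big1 => i _; rewrite addNr mulr0.
apply: le_trans (torsion_upper q u _ _ _ _ q0 hu F d0) _.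
have := rho_energy q n q1; rewrite rho_trace// /rho1 /rho2.
clear; generalize_integrals => *; lra.
Qed.

End Upper.

(** * Lower bound *)

Section Lower.
Context {R : realType}.
Notation freq := (@freq R).
Notation mode_coef := (@mode_coef R).
Notation strip_energy := (@strip_energy R).
Implicit Types (q k x y : R) (f g phi : R * R -> R).

(** The integral over [0, 1] of the square of [trace_err' n]: what Parseval's
identity for y/2 misses after n terms. The constant 1/12 is the integral of
y^2/4. *)
Definition defect n : R := 12^-1 - 2^-1 * \sum_(i < n) freq i ^- 2.

(** The part of y^2/4 that the first n modes miss, normalized to vanish at
y = 0; an additive constant does not change the energy. *)
Definition trace_err n y : R := 4^-1 * (y * y) -
  \sum_(i < n) mode_coef i * (1 - cos (freq i * y)).
Definition trace_err' n y : R := 2^-1 * y -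
  \sum_(i < n) (mode_coef i * freq i) * sin (freq i * y).

(** Antiderivative of the square of [trace_err' n]. *)
Definition trace_err_energy n y : R := 12^-1 * y ^+ 3
  - \sum_(i < n) mode_coef i * freq i * (sin (freq i * y) / freq i ^+ 2
                                   - y * cos (freq i * y) / freq i)
  + sin_energy n (fun i => mode_coef i * freq i) freq y.

Lemma der_trace_err n y : is_derive y 1 (trace_err n) (trace_err' n y).
Proof.
rewrite /trace_err /trace_err'; eapply is_derive_eq; first by der.
cbv beta; congr (_ - _); first by field.
by apply: eq_bigr => i _; ring.
Qed.

Let freq_neq0 i : freq i != 0. Proof. by rewrite gt_eqF// freq_gt0. Qed.

Lemma der_trace_err_energy n y : is_derive y 1 (trace_err_energy n) (trace_err' n y ^+ 2).
Proof.
rewrite /trace_err_energy /trace_err'; eapply is_derive_eq.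
  eapply deriv_add; last first.
    exact: der_sin_energy (fun i => mode_coef i * freq i) freq y (@freq_gt0 R) (@freq_inj R).
  by have f0 := freq_neq0; der.
cbv beta; set S := \sum_(i < n) _ * sin _.
have -> : (2^-1 * y - S) ^+ 2 = 4^-1 * y ^+ 2 - y * S + S ^+ 2 by field.
congr (_ + _); congr (_ + _); first by field.
congr (- _); rewrite mulr_sumr; apply: eq_bigr => i _.
by field; exact: freq_neq0.
Qed.

Lemma cont_trace_err'_sqr n (y : R) : {for y, continuous (fun t => trace_err' n t ^+ 2)}.
Proof. by rewrite /trace_err'; eapply der_continuous; der. Qed.

Lemma trace_err_energy0 n : trace_err_energy n 0 = 0.
Proof.
rewrite /trace_err_energy sin_energyE => [|i]; last by rewrite mulr0 sin0.
rewrite big1 => [|i _]; last by rewrite mulr0 sin0; ring.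
by ring.
Qed.

Lemma trace_err_energy1 n : trace_err_energy n 1 = defect n.
Proof.
rewrite /trace_err_energy sin_energyE => [|i]; last by rewrite mulr1 sin_freq.
have sq i : (mode_coef i * freq i) ^+ 2 = freq i ^- 2.
  have := sqrr_sign R i; rewrite /mode_coef; move: ((-1) ^+ i) => s s2.
  by transitivity (s ^+ 2 * freq i ^- 2); [field; exact: freq_neq0|rewrite s2 mul1r].
have tr i : mode_coef i * freq i * (sin (freq i * 1) / freq i ^+ 2
    - 1 * cos (freq i * 1) / freq i) = freq i ^- 2.
  rewrite mulr1 sin_freq cos_freq [(-1) ^+ i.+1]exprS -sq /mode_coef.
  by move: ((-1) ^+ i) => s; field; exact: freq_neq0.
under [X in _ - X]eq_bigr do rewrite tr.
under [X in _ + _ * X]eq_bigr do rewrite sq.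
by rewrite /defect; field.
Qed.

(** Cauchy-Schwarz in the form of Young's inequality: the derivative of
e/2 y + M(y)/(2e) - s r(y), with M the antiderivative of r'^2 and s = 1 or -1,
is a square divided by 2e. *)
Lemma trace_err_bound n y (e : R) : 0 < e -> defect n <= e ^+ 2 -> 0 <= y <= 1 ->
  `|trace_err n y| <= e.
Proof.
move=> e0 de /andP[y0 y1].
have M1 : trace_err_energy n y <= e ^+ 2.
  apply: le_trans de; rewrite -trace_err_energy1.
  exact: (der_nondecreasing _ _ y 1 y1 (fun t _ => der_trace_err_energy n t)
    (fun t _ => cont_trace_err'_sqr n t) (fun t _ => sqr_ge0 _)).
have key (s : R) : s ^+ 2 = 1 -> s * trace_err n y <= e.
  move=> s2; pose F t := (e / 2) * t + (2 * e)^-1 * trace_err_energy n t + - s * trace_err n t.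
  pose f t := (2 * e)^-1 * (trace_err' n t - s * e) ^+ 2.
  have en : e != 0 by rewrite gt_eqF.
  have dF (t : R) : is_derive t 1 F (f t).
    rewrite /F; eapply is_derive_eq.
      eapply deriv_add; first eapply deriv_add.
      - exact: deriv_cmul (deriv_id t).
      - exact: deriv_cmul (der_trace_err_energy n t).
      - exact: deriv_cmul (der_trace_err n t).
    rewrite /f; have -> : (trace_err' n t - s * e) ^+ 2 =
      trace_err' n t ^+ 2 - 2 * s * e * trace_err' n t + s ^+ 2 * e ^+ 2 by ring.
    by rewrite s2; field.
  have cf (t : R) : {for t, continuous f}.
    by rewrite /f /trace_err'; eapply der_continuous; der.
  have : F 0 <= F y.
    have f0 t : 0 <= f t by rewrite /f mulr_ge0 ?sqr_ge0// invr_ge0 mulr_ge0// ltW.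
    exact: (der_nondecreasing F f 0 y y0 (fun t _ => dF t) (fun t _ => cf t)
      (fun t _ => f0 t)).
  rewrite /F trace_err_energy0.
  have -> : trace_err n 0 = 0.
    rewrite /trace_err big1 => [|i _]; first by ring.
    by rewrite mulr0 cos0 subrr mulr0.
  rewrite !mulr0 !addr0 => h.
  have h1 : e / 2 * y <= e / 2 by rewrite ler_piMr// divr_ge0// ltW.
  have h2 : (2 * e)^-1 * trace_err_energy n y <= e / 2.
    have -> : e / 2 = (2 * e)^-1 * e ^+ 2 by field.
    by rewrite ler_pM2l// invr_gt0 mulr_gt0.
  lra.
rewrite ler_norml; apply/andP; split.
  have m1 : (-1 : R) ^+ 2 = 1 by rewrite sqrrN expr1n.
  have := key (-1) m1; clear; lra.
have := key 1 (expr1n _ _); clear; lra.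
Qed.

(** The first n modes of the harmonic extension to the half-strip, up to a
constant, plus the missing part of the trace damped by exp(-x). *)
Definition competitor n (z : R * R) : R :=
  \sum_(i < n) mode_coef i * (1 + -1 * (cos (freq i * z.2) * expR (- freq i * z.1)))
  + (4^-1 * (z.2 * z.2) + \sum_(i < n) mode_coef i * (-1 + cos (freq i * z.2)))
    * expR (-1 * z.1).

Lemma smooth_competitor n : smooth (competitor n).
Proof.
have [s1 s2] := (@smooth_fst R, @smooth_snd R); have sc c := @smooth_cst R c.
have sco i := @smooth_cos2 R (freq i); have se c := @smooth_expR1 R c.
apply: smooth_add.
  apply: smooth_sum => i; apply: smooth_mul => //; apply: smooth_add => //.
  by apply: smooth_mul => //; exact: smooth_mul.
apply: smooth_mul => //; apply: smooth_add.
  by apply: smooth_mul => //; exact: smooth_mul.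
by apply: smooth_sum => i; apply: smooth_mul => //; exact: smooth_add.
Qed.

Lemma competitor0 n y : competitor n (0, y) = 4^-1 * (y * y).
Proof.
rewrite /competitor /= mulr0 expR0 mulr1 addrCA -big_split /= big1 ?addr0// => i _.
by rewrite mulr0 expR0; ring.
Qed.

Let remE n y : 4^-1 * (y * y) +
  \sum_(i < n) mode_coef i * (-1 + cos (freq i * y)) = trace_err n y.
Proof. by rewrite /trace_err -sumrN; congr (_ + _); apply: eq_bigr => i _; ring. Qed.

Definition cos_mode n (z : R * R) : R :=
  \sum_(i < n) (mode_coef i * freq i * expR (- freq i * z.1)) * cos (freq i * z.2).
Definition sin_mode n (z : R * R) : R :=
  \sum_(i < n) (mode_coef i * freq i * expR (- freq i * z.1)) * sin (freq i * z.2).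

Lemma partial1_competitor n :
  partial1 (competitor n) = fun z => cos_mode n z - trace_err n z.2 * expR (-1 * z.1).
Proof.
apply: partial1_eq => x y; rewrite /competitor /=; eapply is_derive_eq; first by der.
cbv beta; rewrite remE /cos_mode /=; congr (_ + _); last by ring.
by apply: eq_bigr => i _; ring.
Qed.

Lemma partial2_competitor n :
  partial2 (competitor n) = fun z => sin_mode n z + trace_err' n z.2 * expR (-1 * z.1).
Proof.
apply: partial2_eq => x y; rewrite /competitor /=; eapply is_derive_eq; first by der.
cbv beta; rewrite /sin_mode /trace_err' /=; congr (_ + _).
  by apply: eq_bigr => i _; ring.
rewrite mulr0 addr0; congr (_ * _); rewrite -sumrN.
by congr (_ + _); [field|apply: eq_bigr => i _; ring].
Qed.

Lemma bmeas_modes q n : 0 < q ->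
  [/\ bmeas q (cos_mode n), bmeas q (sin_mode n) & bmeas q (fun z => trace_err' n z.2)].
Proof.
move=> q0; have n2 := bmeas_snd q q0.
have nk i : bmeas q (fun z => freq i * z.2) by apply: bmeas_mul => //; exact: bmeas_cst.
have nc i := bmeas_cos _ _ (nk i); have nsn i := bmeas_sin _ _ (nk i).
have ne i := bmeas_expR1 q (- freq i) q0.
have nce i : bmeas q (fun z => mode_coef i * freq i * expR (- freq i * z.1)).
  by apply: bmeas_mul => //; exact: bmeas_cst.
split.
- by apply: bmeas_sum => i; exact: bmeas_mul.
- by apply: bmeas_sum => i; exact: bmeas_mul.
- apply: bmeas_add; first by apply: bmeas_mul => //; exact: bmeas_cst.
  apply: bmeas_opp; apply: bmeas_sum => i; apply: bmeas_mul => //; exact: bmeas_cst.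
Qed.

(** Young's inequality with weight e separates the modes from the damped
error. The modes are orthogonal on [0, 1], but the section of the triangle is
only [0, L]: the antiderivative in y of the nonnegative bound is evaluated at 1
instead of L. *)
Lemma competitor_energy q n (e : R) : 0 < q -> 0 < e -> defect n <= e ^+ 2 ->
  \int[leb2 R]_(z in triangle q)
     (partial1 (competitor n) z ^+ 2 + partial2 (competitor n) z ^+ 2)
  <= (1 + e) * strip_energy n + e ^+ 2 + e.
Proof.
move=> q0 e0 de; have en : e != 0 by rewrite gt_eqF.
have ie0 : 0 <= 1 + e^-1 by rewrite addr_ge0// invr_ge0 ltW.
have [nC nS nr] := bmeas_modes q n q0; have nE := bmeas_expR1 q (-1) q0.
have [_ np1 np2] := smooth_bmeas q _ q0 (smooth_competitor n).
pose f z := (1 + e) * (cos_mode n z ^+ 2 + sin_mode n z ^+ 2)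
  + (1 + e^-1) * expR (-1 * z.1) ^+ 2 * (e ^+ 2 + trace_err' n z.2 ^+ 2).
have nf : bmeas q f.
  rewrite /f; apply: bmeas_add; apply: bmeas_mul; try exact: bmeas_cst.
  - by apply: bmeas_add; exact: bmeas_exprn.
  - by apply: bmeas_mul; [exact: bmeas_cst|exact: bmeas_exprn].
  - apply: bmeas_add; [exact: bmeas_cst|].
    exact: (bmeas_exprn q (fun z => trace_err' n z.2) 2 nr).
apply: (@le_trans _ _ (\int[leb2 R]_(z in triangle q) f z)).
  apply: Rint_le; first by solve_integrable.
    exact: bmeas_integrable.
  move=> z [z1 z1q z2 zl]; rewrite partial1_competitor partial2_competitor /f.
  have y01 : 0 <= z.2 <= 1.
    rewrite ltW//= ltW//; apply: lt_trans zl _.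
    by rewrite gtrBl divr_gt0.
  have re : trace_err n z.2 ^+ 2 <= e ^+ 2.
    rewrite -(real_normK (num_real (trace_err n z.2))).
    have := trace_err_bound n z.2 e e0 de y01; move: `|_| (normr_ge0 (trace_err n z.2)) => a a0 ae.
    by rewrite lerXn2r ?nnegrE ?(ltW e0).
  have young (a b : R) : (a + b) ^+ 2 <= (1 + e) * a ^+ 2 + (1 + e^-1) * b ^+ 2.
    rewrite -subr_ge0.
    have -> : (1 + e) * a ^+ 2 + (1 + e^-1) * b ^+ 2 - (a + b) ^+ 2
        = e * (a - b / e) ^+ 2 by field.
    by rewrite mulr_ge0 ?sqr_ge0// ltW.
  have h1 := young (cos_mode n z) (- (trace_err n z.2 * expR (-1 * z.1))).
  have h2 := young (sin_mode n z) (trace_err' n z.2 * expR (-1 * z.1)).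
  rewrite sqrrN !exprMn in h1 h2.
  have h3 : (1 + e^-1) * (trace_err n z.2 ^+ 2 * expR (-1 * z.1) ^+ 2)
      <= (1 + e^-1) * (e ^+ 2 * expR (-1 * z.1) ^+ 2).
    by apply: ler_wpM2l => //; apply: ler_wpM2r => //; exact: sqr_ge0.
  apply: le_trans (lerD h1 h2) _; rewrite addrACA -mulrDr lerD2l.
  by apply: le_trans (lerD h3 (lexx _)) _; rewrite -mulrDr -mulrDl -mulrA [X in _ * X]mulrC.
pose B x := (1 + e) * (\sum_(i < n)
    - (mode_coef i ^+ 2 * freq i / 2) * expR (- freq i * x) ^+ 2)
  + - ((1 + e^-1) * e ^+ 2) * expR (-1 * x) ^+ 2.
pose dB x := (1 + e) * (\sum_(i < n)
    (mode_coef i * freq i * expR (- freq i * x)) ^+ 2)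
  + (1 + e^-1) * expR (-1 * x) ^+ 2 * (e ^+ 2 + e ^+ 2).
have derB x : is_derive x 1 B (dB x).
  rewrite /B /dB; eapply is_derive_eq; first by der.
  cbv beta; rewrite !mul0r !add0r; congr (_ + _).
    by congr (_ * _); apply: eq_bigr => i _; field.
  by field.
have cdB : continuous dB by move=> x; rewrite /dB; eapply der_continuous; der.
pose dC x i := mode_coef i * freq i * expR (- freq i * x).
pose H x y := (1 + e) * (cos_energy n (dC x) freq y + sin_energy n (dC x) freq y)
  + (1 + e^-1) * expR (-1 * x) ^+ 2 * (e ^+ 2 * y + trace_err_energy n y).
have dH x y : is_derive y 1 (H x) (f (x, y)).
  rewrite /H /f; apply: deriv_add; apply: deriv_cmul.
    apply: deriv_add.
      exact: der_cos_energy _ _ _ (@freq_gt0 R) (@freq_inj R).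
    exact: der_sin_energy _ _ _ (@freq_gt0 R) (@freq_inj R).
  apply: deriv_add; last exact: der_trace_err_energy.
  exact: deriv_scale.
have cH x y : {for y, continuous (fun t => f (x, t))}.
  by rewrite /f /cos_mode /sin_mode /trace_err' /=; eapply der_continuous; der.
apply: (@le_trans _ _ (B q - B 0)).
  apply: (fubini1_le q f (fun x => H x (1 - x / q) - H x 0) B dB q0 nf _ _ derB cdB).
    move=> x /andP[x0 xq].
    have L0 : 0 < 1 - x / q by rewrite subr_gt0 ltr_pdivrMr// mul1r.
    exact: (integral_antiderivative (H x) (fun y => f (x, y)) 0 (1 - x / q) L0
      (fun t _ => dH x t) (fun t _ => cH x t)).
  move=> x /andP[x0 xq].
  have L1 : 1 - x / q <= 1 by rewrite gerBl divr_ge0// ltW.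
  have f0 y : 0 <= f (x, y).
    have s2 (c : R) : 0 <= c ^+ 2 by exact: sqr_ge0.
    apply: addr_ge0; apply: mulr_ge0; try exact: mulr_ge0.
    - by rewrite addr_ge0// ltW.
    - exact: addr_ge0.
    - exact: addr_ge0.
  have : H x (1 - x / q) <= H x 1.
    exact: (der_nondecreasing (H x) (fun y => f (x, y)) _ _ L1 (fun t _ => dH x t)
      (fun t _ => cH x t) (fun t _ => f0 t)).
  have H0 : H x 0 = 0.
    rewrite /H cos_energyE ?sin_energyE ?trace_err_energy0; try by move=> i; rewrite mulr0 sin0.
    by ring.
  have H1 : H x 1 = (1 + e) * (\sum_(i < n) dC x i ^+ 2)
      + (1 + e^-1) * expR (-1 * x) ^+ 2 * (e ^+ 2 + defect n).
    rewrite /H cos_energyE ?sin_energyE ?trace_err_energy1; try by move=> i; rewrite mulr1 sin_freq.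
    by field.
  rewrite H0 H1 subr0 => /le_trans; apply; rewrite /dB lerD2l.
  by apply: ler_wpM2l; rewrite ?lerD2l// mulr_ge0// sqr_ge0.
have -> : strip_energy n = \sum_(i < n) mode_coef i ^+ 2 * freq i / 2.
  by apply: eq_bigr => i _; rewrite mode_coef_sqr.
set S := \sum_(i < n) _ / 2.
have -> : B 0 = - ((1 + e) * S) - (e ^+ 2 + e).
  have ES : \sum_(i < n) - (mode_coef i ^+ 2 * freq i / 2) * expR (- freq i * 0) ^+ 2 = - S.
    rewrite /S -sumrN; apply: eq_bigr => i _.
    by rewrite mulr0 expR0 expr1n mulr1.
  by rewrite /B ES mulr0 expR0 expr1n; field.
have : B q <= 0.
  have s2 (c : R) : 0 <= c ^+ 2 by exact: sqr_ge0.
  rewrite /B -[leRHS]addr0; apply: lerD; last first.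
    by rewrite [leLHS]mulNr oppr_le0 mulr_ge0// mulr_ge0.
  apply: mulr_ge0_le0; first by rewrite addr_ge0// ltW.
  apply: sumr_le0 => i _; rewrite [leLHS]mulNr oppr_le0 mulr_ge0// divr_ge0// mulr_ge0//.
  by rewrite ltW// freq_gt0.
clear; lra.
Qed.

Lemma torsion_lower_strip q u n : 0 < q -> defect n <= q^-1 ^+ 2 ->
  weak_solution (triangle q) sideAC u ->
  q ^+ 3 / 16 + q / 48 - ((1 + q^-1) * strip_energy n + q^-1 ^+ 2 + q^-1)
  <= \int[leb2 R]_(z in triangle q) u z.
Proof.
move=> q0 dq hu; have qi0 : 0 < q^-1 by rewrite invr_gt0.
apply: le_trans (torsion_lower q u _ q0 hu (smooth_competitor n) _).
  by rewrite lerD2l lerN2; exact: competitor_energy.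
by move=> y _; exact: competitor0.
Qed.

End Lower.

(** * Partial sums of zeta(2) and zeta(3), and the asymptotic expansion *)

Section Basel.
Context {R : realType}.
Notation freq := (@freq R).
Notation defect := (@defect R).
Implicit Types (x : R).

Lemma mul_cos_le_sin x : 0 <= x <= pi / 2 -> x * cos x <= sin x.
Proof.
move=> /andP[x0 xp].
pose F t : R := sin t - t * cos t; pose f t : R := t * sin t.
have dF (t : R) : is_derive t 1 F (f t) by rewrite /F /f; der_eq; ring.
have cf (t : R) : {for t, continuous f} by rewrite /f; eapply der_continuous; der.
have f0 t : 0 <= t <= x -> 0 <= f t.
  move=> /andP[t0 tx]; rewrite mulr_ge0// sin_ge0_pi// t0 (le_trans tx)// (le_trans xp)//.
  by rewrite ler_pdivrMr// ler_peMr ?pi_ge0// ler1n.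
have := der_nondecreasing F f 0 x x0 (fun t _ => dF t) (fun t _ => cf t) f0.
by rewrite /F sin0 mul0r subr0 subr_ge0.
Qed.

(** Equivalent to x <= tan x. *)
Lemma inv_sin_sqr_le x : 0 < x -> x <= pi / 2 -> sin x ^- 2 <= x ^- 2 + 1.
Proof.
move=> x0 xp.
have xpi : x < pi.
  apply: le_lt_trans xp _; rewrite ltr_pdivrMr// ltr_pMr ?pi_gt0// ltr1n//.
have s0 : 0 < sin x by apply: sin_gt0_pi; rewrite x0.
have c0 : 0 <= cos x by apply: cos_ge0_pihalf;
  rewrite xp andbT (le_trans _ (ltW x0))// oppr_le0 divr_ge0// pi_ge0.
have h : (x * cos x) ^+ 2 <= sin x ^+ 2.
  rewrite lerXn2r ?nnegrE ?(ltW s0) ?mulr_ge0 ?(ltW x0)//.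
  by apply: mul_cos_le_sin; rewrite (ltW x0).
have cs := cos2Dsin2 x.
have -> : x ^- 2 + 1 = (1 + x ^+ 2) / x ^+ 2 by field; rewrite gt_eqF.
rewrite -[leLHS]mul1r ler_pdivrMr ?exprn_gt0// mulrAC ler_pdivlMr ?exprn_gt0//.
move: h; rewrite exprMn; have -> : cos x ^+ 2 = 1 - sin x ^+ 2 by rewrite -cs addrK.
by rewrite mulrBr mulr1 lerBlDr mul1r mulrDl mul1r.
Qed.

Lemma sum_fold_middle (g : nat -> R) n : \sum_(0 <= i < n.+1 + n) g i =
  \sum_(0 <= i < n) (g i + g (n.+1 + n - i.+1)%N) + g n.
Proof.
rewrite (@big_cat_nat _ _ _ n.+1)//=; last by rewrite leq_addr.
rewrite big_nat_recr//= big_split /= addrAC; congr (_ + _ + _).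
rewrite big_nat_rev /= -{1}[n.+1]add0n big_addn addKn.
by apply: eq_big_nat => i /andP[_ iltn]; congr g; lia.
Qed.

Definition inv_sin_sum (m : nat) : R :=
  \sum_(0 <= i < m.-1) (sin (i.+1%:R * pi / (2 * m%:R))) ^- 2.

(** Doubling m halves all angles. The angles t/2 and pi/2 - t/2 go together, as
1/sin^2 + 1/cos^2 at t/2 is 4/sin^2 at t, and the middle angle pi/4 contributes
2. This recurrence evaluates the sum exactly at powers of 2. *)
Lemma inv_sin_sum_double n :
  inv_sin_sum (2 * n.+1) = 4 * inv_sin_sum n.+1 + 2.
Proof.
rewrite /inv_sin_sum.
have -> : (2 * n.+1).-1 = (n.+1 + n)%N by rewrite mul2n -addnn addnS.
rewrite sum_fold_middle mulr_sumr.
have n0 : n.+1%:R != 0 :> R by rewrite pnatr_eq0.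
have n20 : (2 * n.+1)%:R = 2 * n.+1%:R :> R by rewrite natrM.
have sin4 : sin (n.+1%:R * pi / (2 * (2 * n.+1)%:R)) ^+ 2 = 2^-1 :> R.
  set t := _ / _; have cst : cos t = sin t.
    rewrite -cosBpihalf; have -> : t - pi / 2 = - t.
      by rewrite /t n20; field.
    by rewrite cosN.
  by have := cos2Dsin2 t; rewrite cst; lra.
congr (_ + _); last by rewrite sin4 invrK.
apply: eq_big_nat => i /andP[_ iltn].
pose t : R := i.+1%:R * pi / (2 * (2 * n.+1)%:R).
have -> : (n.+1 + n - i.+1).+1%:R * pi / (2 * (2 * n.+1)%:R) = pi / 2 - t :> R.
  have -> : (n.+1 + n - i.+1).+1 = (2 * n.+1 - i.+1)%N by lia.
  by rewrite natrB ?/t ?n20; [field|lia].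
have -> : i.+1%:R * pi / (2 * n.+1%:R) = t + t :> R by rewrite /t n20; field.
rewrite -/t.
have -> : sin (pi / 2 - t) = cos t :> R.
  by rewrite -[_ - t]opprB sinN sinBpihalf opprK.
have tpos : 0 < t.
  by rewrite divr_gt0 ?mulr_gt0 ?pi_gt0 ?ltr0n.
have tlt : t < pi / 2.
  rewrite /t n20 ltr_pdivrMr ?mulr_gt0 ?ltr0n//.
  have -> : pi / 2 * (2 * (2 * n.+1%:R)) = (2 * n.+1%:R) * pi :> R by field.
  by rewrite ltr_pM2r ?pi_gt0// -natrM ltr_nat; lia.
have s0 : sin t != 0 by rewrite gt_eqF// sin_gt0_pihalf// tpos tlt.
have c0 : cos t != 0.
  by rewrite gt_eqF// cos_gt0_pihalf// tlt andbT (lt_trans _ tpos)// oppr_lt0 divr_gt0// pi_gt0.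
rewrite sinD; have cs := cos2Dsin2 t; move: (sin t) (cos t) s0 c0 cs => a c a0 c0 cs.
transitivity ((c ^+ 2 + a ^+ 2) / (c ^+ 2 * a ^+ 2)); first by field; rewrite a0 c0.
rewrite cs; have -> : a * c + c * a = 2 * a * c by ring.
by field; rewrite a0 c0.
Qed.

Lemma inv_sin_sum_pow2 m : inv_sin_sum (2 ^ m) = 2 * (4 ^+ m - 1) / 3.
Proof.
elim: m => [|m IHm]; first by rewrite /inv_sin_sum big_geq// expr0 subrr; ring.
rewrite expnS; have : (0 < 2 ^ m)%N by rewrite expn_gt0.
move: IHm; case: (2 ^ m)%N => // n IHn _.
by rewrite inv_sin_sum_double IHn exprS; field.
Qed.

(** Summing [inv_sin_sqr_le] over the angles k / (2 m), with m a power of 2,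
compares the partial sum of 1 / k^2 with the explicit sum of 1 / sin^2. *)
Lemma defect_pow2 m : defect (2 ^ m).-1 <= (2 ^+ m)^-1.
Proof.
have M0 : (0 < 2 ^ m)%N by rewrite expn_gt0.
have MR : (2 ^ m)%:R = 2 ^+ m :> R by rewrite natrX.
have m0 : 0 < 2 ^+ m :> R by rewrite exprn_gt0.
have h : inv_sin_sum (2 ^ m) <=
    \sum_(i < (2 ^ m).-1) (4 * (2 ^+ m) ^+ 2 * freq i ^- 2 + 1).
  rewrite /inv_sin_sum big_mkord; apply: ler_sum => i _.
  have := ltn_ord i; set j := nat_of_ord i => jM.
  have x0 : 0 < j.+1%:R * pi / (2 * (2 ^ m)%:R) :> R.
    by rewrite divr_gt0 ?mulr_gt0 ?pi_gt0 ?ltr0n.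
  have xp : j.+1%:R * pi / (2 * (2 ^ m)%:R) <= pi / 2 :> R.
    rewrite MR ler_pdivrMr ?mulr_gt0//.
    have -> : pi / 2 * (2 * 2 ^+ m) = 2 ^+ m * pi :> R by field.
    by rewrite ler_wpM2r ?pi_ge0// -MR ler_nat; lia.
  apply: le_trans (inv_sin_sqr_le _ x0 xp) _; rewrite lerD2r MR /freq.
  have jn : j.+1%:R != 0 :> R by rewrite pnatr_eq0.
  have pn : pi != 0 :> R by rewrite gt_eqF// pi_gt0.
  have mn : 2 ^+ m != 0 :> R by rewrite gt_eqF.
  rewrite -/j; move: j.+1%:R pi (2 ^+ m) jn pn mn => a b c a0 b0 c0.
  rewrite le_eqVlt; apply/orP; left; apply/eqP; field.
  by rewrite ?a0 ?b0 ?c0.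
rewrite big_split /= -mulr_sumr sumr_const card_ord inv_sin_sum_pow2 in h.
rewrite /defect; move: h; set S := \sum_(i < _) _; move=> h.
have e4 : 4 ^+ m = (2 ^+ m) ^+ 2 :> R by rewrite -exprM mulnC exprM; congr (_ ^+ m); ring.
have h' : 2 * ((2 ^+ m) ^+ 2 - 1) / 3 <= 4 * (2 ^+ m) ^+ 2 * S + 2 ^+ m.
  rewrite -[in leLHS]e4; apply: le_trans h _; rewrite lerD2l -MR ler_nat; lia.
have M1 : 1 <= 2 ^+ m :> R by rewrite exprn_ege1// ler1n.
clear h e4; move: (2 ^+ m) S m0 M1 h' {MR} => x S x0 x1 h'.
rewrite -(@ler_pM2r _ (x ^+ 2)) ?exprn_gt0//.
have -> : x^-1 * x ^+ 2 = x by field; rewrite gt_eqF.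
nra.
Qed.

(** The inequality pi^2/6 <= zeta(2) of Euler's identity. *)
Lemma defect_small (e : R) : 0 < e -> exists n, defect n <= e.
Proof.
move=> e0; pose m := (Num.truncn (e^-1)).+1.
exists (2 ^ m).-1; apply: le_trans (defect_pow2 m) _.
rewrite invf_ple ?posrE ?exprn_gt0//.
apply: le_trans (ltW (truncnS_gt _)) _.
by rewrite -natrX ler_nat ltnW// ltn_expl.
Qed.

Notation mode_coef := (@mode_coef R).
Notation strip_energy := (@strip_energy R).

Definition zeta3_partial : nat -> R := series (fun n : nat => n.+1%:R `^ (- 3)).

Lemma zeta3_partialE n : zeta3_partial n = \sum_(i < n) (i.+1%:R ^+ 3)^-1.
Proof.
rewrite /zeta3_partial seriesEord /=; apply: eq_bigr => i _.
by rewrite powR_invn// ler0n.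
Qed.

Lemma zeta3_partial_nd : nondecreasing_seq zeta3_partial.
Proof.
apply/nondecreasing_seqP => n; rewrite !zeta3_partialE big_ord_recr /= lerDl.
by rewrite invr_ge0 exprn_ge0.
Qed.

(** The increment 2 / ((n+1)(n+2)) of the right-hand side dominates the new term. *)
Lemma zeta3_partial_ub n : zeta3_partial n <= 3 - 2 / n.+1%:R.
Proof.
rewrite zeta3_partialE; elim: n => [|n IHn]; first by rewrite big_ord0 divr1; lra.
rewrite big_ord_recr /=; apply: le_trans (lerD IHn (lexx _)) _.
rewrite -[n.+2]addn1 natrD; have : 1 <= n.+1%:R :> R by rewrite ler1n.
move: n.+1%:R => x x1; have x0 : 0 < x by apply: lt_le_trans x1.
rewrite -subr_ge0.
have -> : 3 - 2 / (x + 1) - (3 - 2 / x + (x ^+ 3)^-1) =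
    (2 * x ^+ 2 - x - 1) / (x ^+ 3 * (x + 1)).
  by field; rewrite ?gt_eqF ?addr_gt0.
apply: divr_ge0; last by rewrite mulr_ge0 ?exprn_ge0 ?addr_ge0// ltW.
nra.
Qed.

Lemma zeta3_partial_cvg : cvgn zeta3_partial.
Proof.
apply: nondecreasing_is_cvgn; first exact: zeta3_partial_nd.
exists 3 => _ [n _ <-]; apply: le_trans (zeta3_partial_ub n) _.
by rewrite gerBl divr_ge0.
Qed.

Lemma strip_energyE n : strip_energy n = (2 * pi ^+ 3)^-1 * zeta3_partial n.
Proof.
rewrite zeta3_partialE mulr_sumr; apply: eq_bigr => i _; rewrite /freq.
have jn : i.+1%:R != 0 :> R by rewrite pnatr_eq0.
have pn : pi != 0 :> R by rewrite gt_eqF// pi_gt0.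
by move: i.+1%:R pi jn pn => a b a0 b0; field; rewrite ?a0 ?b0.
Qed.

Definition half_strip_energy : R := zeta 3 / (2 * pi ^+ 3).

Lemma strip_energy_le n : strip_energy n <= half_strip_energy.
Proof.
rewrite strip_energyE /half_strip_energy mulrC ler_wpM2r//.
  by rewrite invr_ge0 mulr_ge0// exprn_ge0// pi_ge0.
exact: nondecreasing_cvgn_le zeta3_partial_nd zeta3_partial_cvg n.
Qed.

Lemma strip_energy_approx (e : R) : 0 < e ->
  exists n, half_strip_energy - e <= strip_energy n.
Proof.
move=> e0; have p0 : 0 < 2 * pi ^+ 3 :> R by rewrite mulr_gt0// exprn_gt0// pi_gt0.
have /cvgrPdist_lt /(_ (e * (2 * pi ^+ 3))) := zeta3_partial_cvg.
rewrite mulr_gt0// => /(_ isT) [n _ /(_ n (leqnn n)) /=] h; exists n.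
rewrite strip_energyE /half_strip_energy mulrC lerBlDr -[leRHS]addrC -lerBlDr.
rewrite -mulrBr mulrC ler_pdivrMr//; apply: le_trans (ltW h).
exact: ler_norm.
Qed.

Lemma torsion_asymptotic q u : 1 <= q -> weak_solution (triangle q) sideAC u ->
  `|\int[leb2 R]_(z in triangle q) u z
    - (q ^+ 3 / 16 + q / 48 - half_strip_energy)|
  <= (11 * half_strip_energy + 2) * q^-1.
Proof.
move=> q1 hu; have q0 : 0 < q by apply: lt_le_trans q1.
have qi0 : 0 < q^-1 by rewrite invr_gt0.
have qi1 : q^-1 <= 1 by rewrite invf_le1.
(* The numbers of modes in the two bounds depend on q, and the modes left out
   cost at most a multiple of 1/q. *)
have [n hn] := defect_small (q^-1 ^+ 2) (exprn_gt0 2 qi0).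
have [m hm] := strip_energy_approx q^-1 qi0.
have lo := torsion_lower_strip q u n q0 hn hu.
have up := torsion_upper_strip q u m q1 hu.
have En := strip_energy_le n; have Em := strip_energy_le m.
have E0 : 0 <= half_strip_energy.
  by apply: le_trans (strip_energy_le 0%N); rewrite /strip_energy big_ord0.
clear hu hn; move: lo up; generalize_integrals => T.
move: (strip_energy n) (strip_energy m) half_strip_energy En Em E0 hm.
move=> en em E0 hn hm E00 hm'.
move: (q ^+ 3 / 16 + q / 48) => W; move: (q^-1) qi0 qi1 hm' => d d0 d1 hm'.
have h1 : d * en <= d * E0 by rewrite ler_pM2l.
have h2 : d * em <= d * E0 by rewrite ler_pM2l.
have h3 : d ^+ 2 <= d by rewrite expr2 ler_piMr// ltW.
have h4 : 0 <= d * E0 by rewrite mulr_ge0// ltW.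
clear q1 q0 q u n m => lo up.
rewrite ler_norml; apply/andP; split; lra.
Qed.

End Basel.

Theorem theorem1p3 (R : realType) (u : R -> R * R -> R)
    (hu : forall q : R, 0 < q -> weak_solution (triangle q) sideAC (u q)) :
  (fun q : R => \int[leb2 R]_(z in triangle q) u q z)
    = (fun q : R => q ^+ 3 / 16 + q / 48 - zeta 3 / (2 * pi ^+ 3))
      +O_ (pinfty_nbhs R) (fun q : R => q^-1).
Proof.
apply/eqaddOP; exists (11 * half_strip_energy + 2 : R).
split; first exact: num_real.
move=> k hk; exists 1; split; first exact: num_real.
move=> q q1; have q0 : 0 < q by apply: lt_trans q1.
apply: le_trans (torsion_asymptotic q (u q) (ltW q1) (hu q q0)) _.
by rewrite ger0_norm ?invr_ge0 ?(ltW q0)// ler_wpM2r ?invr_ge0 ?(ltW q0)// ltW.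
Qed.
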